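(* Let $n \ge 2$, let $\Omega \subset \mathbb{R}^n$ be open, and let $\varphi \in W^{1,1}_0(\Omega)$ with $\varphi \ge 0$ a.e. in $\Omega$. Then $$\|\varphi\|_{L^\infty(\Omega)} \le \frac{1}{n \omega_n^{1/n}} \int_\Omega \frac{|\nabla \varphi(x)|}{[m_n(\{ z \in \Omega : \varphi(z) \ge \varphi(x) \})]^{\frac{n-1}{n}}} \, dm_n(x).$$
   Context: $m_n$ is $n$-dimensional Lebesgue measure and $\omega_n = m_n(\mathbb{B}^n)$ is the measure of the unit ball of $\mathbb{R}^n$. $W^{1,1}_0(\Omega)$ is the closure of $C_c^\infty(\Omega)$ in $W^{1,1}(\Omega)$. Both sides are allowed to equal $+\infty$; in the integrand, $1/\infty = 0$ (the denominator vanishes only on a set of measure zero). *)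

(* Defs.v *)
From HB Require Import structures.
From mathcomp Require Import all_boot all_order all_algebra.
From mathcomp Require Import all_classical all_reals all_analysis.

Set Implicit Arguments.
Unset Strict Implicit.
Unset Printing Implicit Defensive.

Import Order.TTheory GRing.Theory Num.Def Num.Theory.
Import numFieldNormedType.Exports.

Local Open Scope classical_set_scope.
Local Open Scope ring_scope.

(** R^n is ['rV[R]_n].  Its norm in the library is the sup norm, which gives the
    usual topology and differentiability; the Euclidean norm is [enorm] below. *)

Definition rV_display : measure_display.
Proof. exact: default_measure_display. Qed.

Section rV_measurable.
Context (R : realType) (n : nat).

Definition rV_coord (i : 'I_n) (v : 'rV[R]_n) : measurableTypeR R := v ord0 i.

Let rV_set0 : g_sigma_preimage rV_coord set0.
Proof. exact: sigma_algebra0. Qed.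

Let rV_setC A : g_sigma_preimage rV_coord A -> g_sigma_preimage rV_coord (~` A).
Proof. exact: sigma_algebraC. Qed.

Let rV_bigcup (F : _^nat) : (forall i, g_sigma_preimage rV_coord (F i)) ->
  g_sigma_preimage rV_coord (\bigcup_i (F i)).
Proof. exact: sigma_algebra_bigcup. Qed.

(* Borel sigma-algebra of R^n, generated by the coordinate projections *)
HB.instance Definition _ := @isMeasurable.Build rV_display
  'rV[R]_n (g_sigma_preimage rV_coord) rV_set0 rV_setC rV_bigcup.

Lemma measurable_rV_coord (i : 'I_n) : measurable_fun [set: 'rV[R]_n] (rV_coord i).
Proof.
move=> _ Y mY; rewrite setTI; apply: sub_sigma_algebra => /=.
rewrite -bigcup_seq/=; exists i => /=; first by rewrite mem_index_enum.
by exists Y => //; rewrite setTI.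
Qed.

End rV_measurable.

Lemma measurable_fun_rV d (T : measurableType d) (R : realType) (n : nat)
    (f : T -> 'rV[R]_n) :
  (forall i, measurable_fun [set: T] (rV_coord i \o f)) ->
  measurable_fun [set: T] f.
Proof.
move=> mf; apply: (@measurability _ _ _ _ _ _
  (\big[setU/set0]_(i < n) preimage_set_system setT (@rV_coord R n i) measurable)).
  by [].
move=> _ [B + <-]; rewrite -bigcup_seq/= => -[i _ [Y mY <-]].
by rewrite setTI; apply: (mf i measurableT Y mY).
Qed.

Section consR.
Context (R : realType) (n : nat).

Definition consR (p : measurableTypeR R * 'rV[R]_n) : 'rV[R]_(1 + n) :=
  row_mx (const_mx p.1) p.2.

Lemma measurable_consR : measurable_fun setT consR.
Proof.
apply: measurable_fun_rV => i; case: (split_ordP i) => j ->.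
  rewrite (_ : _ \o _ = fst); first exact: measurable_fst.
  by apply/funext => -[x v]; rewrite /= /rV_coord /consR row_mxEl mxE.
rewrite (_ : _ \o _ = rV_coord j \o snd).
  by apply: measurableT_comp; [exact: measurable_rV_coord|exact: measurable_snd].
by apply/funext => -[x v]; rewrite /= /rV_coord /consR row_mxEr.
Qed.

Definition unconsR (v : 'rV[R]_(1 + n)) : measurableTypeR R * 'rV[R]_n :=
  (lsubmx v ord0 ord0, rsubmx v).

Lemma measurable_unconsR : measurable_fun setT unconsR.
Proof.
apply/measurable_fun_pairP; split => /=.
  rewrite (_ : _ \o _ = rV_coord (lshift n ord0)); first exact: measurable_rV_coord.
  by apply/funext => v; rewrite /= /rV_coord mxE.
apply: measurable_fun_rV => i.
rewrite (_ : _ \o _ = rV_coord (rshift 1 i)); first exact: measurable_rV_coord.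
by apply/funext => v; rewrite /= /rV_coord mxE.
Qed.

Lemma consRK : cancel consR unconsR.
Proof. by move=> [x v]; rewrite /unconsR row_mxKl row_mxKr mxE. Qed.

End consR.

Section lebesgue_step.
Context (R : realType) (n : nat).
Variable mu : {sigma_finite_measure set 'rV[R]_n -> \bar R}.
Local Open Scope ereal_scope.

Definition leb_step : set 'rV[R]_n.+1 -> \bar R :=
  pushforward (@lebesgue_measure R \x mu) (@consR R n).

Let leb_step0 : leb_step set0 = 0.
Proof. by rewrite /leb_step /pushforward preimage_set0 measure0. Qed.

Let leb_step_ge0 A : 0 <= leb_step A.
Proof. by rewrite /leb_step /pushforward; exact: measure_ge0. Qed.

Let leb_step_sigma_additive : semi_sigma_additive leb_step.
Proof.
have mp (A : set 'rV[R]_n.+1) :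
    measurable A -> measurable (@consR R n @^-1` A).
  by move=> mA; rewrite -[X in measurable X]setTI; exact: measurable_consR.
move=> F mF tF mUF; rewrite /leb_step /pushforward preimage_bigcup.
apply: measure_semi_sigma_additive.
- by move=> k; exact: mp.
- apply/trivIsetP => /= i j _ _ ij; rewrite -preimage_setI.
  by move/trivIsetP : tF => /(_ _ _ _ _ ij) ->//; rewrite preimage_set0.
- by rewrite -preimage_bigcup; exact: mp.
Qed.

HB.instance Definition _ := isMeasure.Build _ _ _ leb_step
  leb_step0 leb_step_ge0 leb_step_sigma_additive.

Let leb_step_sigma_finite : sigma_finite setT leb_step.
Proof.
have /sigma_finiteP[F [FT ndF mF]] := sigma_finiteT (@lebesgue_measure R).
have /sigma_finiteP[G [GT ndG mG]] := sigma_finiteT mu.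
exists (fun k => @unconsR R n @^-1` (F k `*` G k)).
  apply/seteqP; split=> // v _.
  have [i _ Fi] : (\bigcup_i F i) (unconsR v).1 by rewrite -FT.
  have [j _ Gj] : (\bigcup_i G i) (unconsR v).2 by rewrite -GT.
  exists (maxn i j) => //; split.
    by have /subsetPset := ndF _ _ (leq_maxl i j); apply.
  by have /subsetPset := ndG _ _ (leq_maxr i j); apply.
move=> k; have [mFk Fkoo] := mF k; have [mGk Gkoo] := mG k; split.
  rewrite -[X in measurable X]setTI.
  by apply: measurable_unconsR => //; exact: measurableX.
rewrite /leb_step /pushforward -comp_preimage.
rewrite (_ : @unconsR R n \o _ = id) ?preimage_id; last first.
  by apply/funext => p; exact: consRK.
by rewrite product_measure1E// lte_mul_pinfty// ge0_fin_numE.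
Qed.

HB.instance Definition _ := Measure_isSigmaFinite.Build _ _ _ leb_step
  leb_step_sigma_finite.

Definition leb_stepM : {sigma_finite_measure set 'rV[R]_n.+1 -> \bar R} := leb_step.
End lebesgue_step.

(* n-fold product of [lebesgue_measure], on Borel sets *)
Fixpoint lebesgue_rV (R : realType) (n : nat) :
    {sigma_finite_measure set 'rV[R]_n -> \bar R} :=
  match n with
  | 0%N => @dirac _ 'rV[R]_0 0 R
  | k.+1 => leb_stepM (lebesgue_rV R k)
  end.

(* n-dimensional Lebesgue measure: the completion of [lebesgue_rV], so that
   "measurable" for [lebn R n] means Lebesgue measurable *)
Definition lebn (R : realType) (n : nat) :=
  @completed_measure_extension _ _ R (lebesgue_rV R n).
Arguments lebn : clear implicits.

HB.instance Definition _ (R : realType) (n : nat) := Measure.on (lebn R n).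

Section sobolev.
Context (R : realType) (n : nat).
Implicit Types (Omega : set 'rV[R]_n) (u : 'rV[R]_n -> R)
  (g : 'rV[R]_n -> 'rV[R]_n).

Local Notation mu := (lebn R n).

Definition enorm (v : 'rV[R]_n) : R := Num.sqrt (\sum_(i < n) (v ord0 i) ^+ 2).

Definition unit_ball_measure : \bar R := mu [set v | enorm v < 1].

Definition partial (i : 'I_n) u : 'rV[R]_n -> R := 'D_(delta_mx ord0 i) u.

Definition grad u (x : 'rV[R]_n) : 'rV[R]_n := \row_(i < n) partial i u x.

(* C^oo: every iterated partial derivative of [u] is (Frechet) differentiable *)
Definition smooth u : Prop :=
  forall (s : seq 'I_n) (x : 'rV[R]_n), differentiable (foldr partial u s) x.

Definition supp u : set 'rV[R]_n := closure [set x | u x != 0].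

(* C_c^oo(Omega), as functions on R^n extended by 0 outside Omega *)
Definition test_function Omega u : Prop :=
  [/\ smooth u, compact (supp u) & supp u `<=` Omega].

Definition integrable_on Omega u : Prop := mu.-integrable Omega (EFin \o u).

Local Open Scope ereal_scope.

(* [g] is a version of the weak gradient of [u], in L^1(Omega; R^n).  Elements of
   W^{1,1}(Omega) are represented by functions on R^n whose values outside Omega
   are irrelevant. *)
Definition weak_gradient Omega u g : Prop :=
  (forall i, integrable_on Omega (fun x => g x ord0 i)) /\
  forall psi, test_function Omega psi -> forall i,
    \int[mu]_(x in Omega) (u x * partial i psi x)%:E =
    - \int[mu]_(x in Omega) (g x ord0 i * psi x)%:E.

Definition sobolev11 Omega u : Prop :=
  integrable_on Omega u /\ exists g, weak_gradient Omega u g.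

(* W^{1,1}-norm of [u], where [g] is a version of its weak gradient *)
Definition sobolev11_norm Omega u g : \bar R :=
  \int[mu]_(x in Omega) `|u x|%:E + \int[mu]_(x in Omega) (enorm (g x))%:E.

(* closure of C_c^oo(Omega) in W^{1,1}(Omega).  The weak gradient is unique up to
   a.e. equality, so the norm does not depend on the version [g]; one exists by
   the first conjunct. *)
Definition sobolev11_0 Omega u : Prop :=
  sobolev11 Omega u /\
  forall g, weak_gradient Omega u g ->
  forall e : R, (0 < e)%R ->
  exists2 psi, test_function Omega psi &
    sobolev11_norm Omega (u \- psi)%R (g \- grad psi)%R < e%:E.

(* The extension by 0 outside Omega does not affect the essential supremum of
   [`|u|] over Omega. *)
Definition Linfty_norm Omega u : \bar R := 'N[mu]_+oo [(EFin \o u) \_ Omega].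

End sobolev.

(* Main.v *)
From HB Require Import structures.
Require Import Defs.
From mathcomp Require Import all_boot all_order all_algebra.
From mathcomp Require Import all_classical all_reals all_analysis.
From mathcomp Require Import measurable_realfun ess_sup_inf.
From mathcomp Require Import ring lra.

Set Implicit Arguments.
Unset Strict Implicit.
Unset Printing Implicit Defensive.

Import Order.TTheory GRing.Theory Num.Def Num.Theory.
Import numFieldNormedType.Exports.

Local Open Scope classical_set_scope.
Local Open Scope ring_scope.
Local Open Scope ereal_scope.

(** The proof rests on a form of the isoperimetric inequality stated directly for
functions and two of their levels. Write [w] for the [n]-th root of the
measure of the unit ball. For a test function [u] and levels [0 < r < s < t],
[[
  n w (t - s) |{u > t}|^((n-1)/n) <= int_{r < u <= t} |grad u|
]]
([test_level_bound]). By the Brunn-Minkowski inequality ([brunn_minkowski]),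
adding to a superlevel set [{u > c}] all the points at distance less than [k]
increases its measure by at least [n k w |{u > c}|^((n-1)/n)]
([lebn_enlarge_diff]). A point [x] is added at level [c] only if [c] lies
between [u x] and [u x + k (|grad u x| + o(1))]. So, when [c] runs through an
arithmetic progression of step [h] in [[s, t]], [h] times the number of levels at
which [x] is added is at most [k |grad u x| + o(k) + h], and it is zero unless
[r < u x <= t]. Integrating in [x], dividing by [k] and letting [h], then [k],
tend to zero gives the bound.

Brunn-Minkowski itself is proved by induction on the dimension. The measure of a
set is the integral of the measures of its slices, and the induction hypothesis
bounds the slices of the sum of two sets from below. So each superlevel set of the
slice measure of the sum contains the sum of two superlevel sets of the slice
measures of the summands, and on the line the measure of a sumset is at least the
sum of the measures.

Let now [phi] be the Sobolev function and [psi] a test function close to it. The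
superlevel sets and the strips between two levels of [phi] and [psi] agree,
after a shift of the levels by [k], outside the set where
[k <= |phi - psi|], whose measure is small by Markov's inequality. Hence [phi]
satisfies the same bound, with its weak gradient and with no slack
([sobolev_level_bound]).

The conclusion is a Riemann sum argument. Let [m t] be the measure of
[{phi >= t}], and cut [[t0, T]] into [N] equal steps. On the strip between
[t_i] and [t_(i+1)] the integrand is at least [|grad phi| / (m t_i)^((n-1)/n)],
so its integral there is at least
[n w (t_(i+1) - t_i) (m t_(i+1) / m t_i)^((n-1)/n)]. Since [m] is monotone, the
[N] powers of ratios add up to at least [N - m t0 / m T] ([sum_ratio_ge]). Letting [N] tend
to infinity and [t0] to zero bounds [n w T] by the weighted integral for every
[T > 0] such that [m T > 0] ([level_le_weighted]). Any nonnegative bound on these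
[T] bounds the essential supremum of [phi]. *)

(** * Elementary inequalities *)

(** Convexity of [t ^+ n.+1], as a tangent inequality. It serves to add up the sizes
of two slices, and to turn an increment of the root of a measure into an increment
of the measure. *)
Lemma bernoulli_tangent (R : realFieldType) (t m : R) n : (0 <= t -> 0 <= m ->
  m ^+ n.+1 + n.+1%:R * m ^+ n * (t - m) <= t ^+ n.+1)%R.
Proof.
move=> t0 m0; elim: n => [|n IHn]; first by rewrite !expr1 expr0; lra.
rewrite [leRHS]exprS; apply: (le_trans _ (ler_wpM2l t0 IHn)).
rewrite -subr_ge0.
have -> : (t * (m ^+ n.+1 + n.+1%:R * m ^+ n * (t - m)) -
   (m ^+ n.+2 + n.+2%:R * m ^+ n.+1 * (t - m)) =
   n.+1%:R * m ^+ n * (t - m) ^+ 2)%R.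
  rewrite !exprS -natr1; ring.
by rewrite mulr_ge0 ?sqr_ge0// mulr_ge0 ?exprn_ge0.
Qed.

(** Convexity of the power [n.+1] at [p / a] and [q / b], with the weights
[a = x / (x + y)] and [b = y / (x + y)]: both tangents are taken at their
weighted mean [p + q]. This is the arithmetic of the induction step of
Brunn-Minkowski. *)
Lemma power_mean_two (R : realFieldType) (x y p q : R) n :
  (0 < x -> 0 < y -> 0 < p -> 0 < q ->
  (p + q) ^+ n.+1 <= (x + y) ^+ n * (p ^+ n.+1 / x ^+ n + q ^+ n.+1 / y ^+ n))%R.
Proof.
move=> x0 y0 p0 q0.
have xy0 : (0 < x + y)%R by lra.
have pq0 : (0 <= p + q)%R by lra.
have key (u v : R) : (0 < u -> 0 < v ->
    u / (x + y) * ((p + q) ^+ n.+1 + n.+1%:R * (p + q) ^+ n * (v * (x + y) / u - (p + q)))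
    <= (x + y) ^+ n * (v ^+ n.+1 / u ^+ n))%R.
  move=> u0 v0.
  have c0 : (0 <= v * (x + y) / u)%R by rewrite divr_ge0 ?mulr_ge0// ltW.
  have -> : ((x + y) ^+ n * (v ^+ n.+1 / u ^+ n) =
             u / (x + y) * (v * (x + y) / u) ^+ n.+1)%R.
    rewrite !exprMn exprVn !exprS; field.
    by rewrite expf_neq0 !gt_eqF.
  by rewrite ler_wpM2l ?divr_ge0 ?(ltW u0) ?(ltW xy0)//; exact: bernoulli_tangent.
rewrite mulrDr; apply: (le_trans _ (lerD (key _ _ x0 p0) (key _ _ y0 q0))).
rewrite le_eqVlt; apply/orP; left; apply/eqP.
by field; rewrite !gt_eqF.
Qed.

(** * Affine maps and sumsets on the line *)

Section line.
Context {R : realType}.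
Local Notation lam := (@lebesgue_measure R).

Lemma lebesgue_measure_affine (c d : R) (A : set R) : (0 < c)%R ->
  measurable A -> lam A = c%:E * lam ((fun x : R => c * x + d)%R @^-1` A).
Proof.
move=> c0 mA.
pose f := (fun x : R => c * x + d)%R : measurableTypeR R -> measurableTypeR R.
have mf : measurable_fun setT f.
  apply: measurable_funD => //; exact: mulrl_measurable.
pose mu : {measure set (measurableTypeR R) -> \bar R} :=
  mscale (NngNum (ltW c0)) (pushforward lam f).
rewrite (@lebesgue_measure_unique _ (mu mf))//= => _ [[a b] _ <-].
rewrite /mu /= /mscale /= /pushforward /=.
rewrite (_ : f @^-1` _ = `](a - d) / c, (b - d) / c]%classic)%R; last first.
  apply/seteqP; split => x /=; rewrite !in_itv /= /f ltr_pdivrMr// ler_pdivlMr//;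
    move=> /andP[h1 h2]; apply/andP; split; lra.
rewrite !lebesgue_measure_itv /= !lte_fin ltr_pM2r ?invr_gt0// ltrD2r.
case: ifP => _; last by rewrite mule0.
by rewrite -!EFinD -EFinM; congr (_%:E); field; rewrite gt_eqF.
Qed.

Lemma measurable_affine_preimage (c d : R) (A : set R) :
  measurable A -> measurable ((fun x : R => c * x + d)%R @^-1` A).
Proof.
move=> mA; rewrite -[X in measurable X]setTI.
have mf : measurable_fun setT
  ((fun x : R => c * x + d)%R : measurableTypeR R -> measurableTypeR R).
  by apply: measurable_funD => //; exact: mulrl_measurable.
exact: mf.
Qed.

Lemma lebesgue_measure_shift (d : R) (A : set R) :
  measurable A -> lam ((fun x : R => x + d)%R @^-1` A) = lam A.
Proof.
move=> mA; rewrite (@lebesgue_measure_affine 1 d A ltr01 mA) mul1e.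
by congr (lam _); apply/seteqP; split => x /=; rewrite mul1r.
Qed.

Let measurable_shift (d : R) (A : set R) :
  measurable A -> measurable ((fun x : R => x + d)%R @^-1` A).
Proof.
move=> mA; have := @measurable_affine_preimage 1 d A mA.
by rewrite (_ : _ @^-1` A = (fun x : R => x + d)%R @^-1` A)//;
  apply/seteqP; split => x /=; rewrite mul1r.
Qed.

(** The translates [K + min L] and [max K + L] lie in the sumset and share only
the point [max K + min L]. *)
Let sumset_compact (K L U : set R) : compact K -> compact L -> measurable U ->
  K !=set0 -> L !=set0 ->
  (forall x y, K x -> L y -> U (x + y)%R) -> lam K + lam L <= lam U.
Proof.
move=> cK cL mU K0 L0 KLU.
have wid (A : set R) : {within A, continuous (@id R)}.
  by apply: continuous_subspaceT => x; exact: cvg_id.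
have [k /[!inE] Kk kmax] := compact_EVT_max K0 cK (wid K).
have [l /[!inE] Ll lmin] := compact_EVT_min L0 cL (wid L).
have mK := compact_measurable cK.
have mL := compact_measurable cL.
pose K' := (fun x : R => x + (- l))%R @^-1` K.
pose L' := (fun x : R => x + (- k))%R @^-1` L.
have mK' : measurable K' by exact: measurable_shift.
have mL' : measurable L' by exact: measurable_shift.
have mp : measurable [set (k + l)%R] by exact: measurable_set1.
have -> : lam K = lam K' by rewrite lebesgue_measure_shift.
have -> : lam L = lam (L' `\` [set (k + l)%R]).
  rewrite -(@lebesgue_measure_shift (- k) L)// -/L'.
  rewrite -[in LHS](@setDKU _ (L' `&` [set (k + l)%R]) L'); last exact: subIsetl.
  rewrite measureU//=; last 3 first.
  - by apply: measurableD => //; exact: measurableI.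
  - exact: measurableI.
  - by apply/seteqP; split => // x [[_ h1] h2].
  rewrite [X in _ + X](_ : _ = 0) ?adde0; last first.
    apply: (@subset_measure0 _ _ _ lam _ [set (k + l)%R]) => //.
    - exact: measurableI.
    - exact: lebesgue_measure_set1.
  congr (lam _); apply/seteqP; split => x /= [h1 h2].
    by split => // xkl; apply: h2.
  by split => // -[_ xkl]; exact: h2.
rewrite -measureU//; last 2 first.
- exact: measurableD.
- apply/seteqP; split => // x [/= xK [/= xL]].
  have := kmax _ (mem_set xK); have := lmin _ (mem_set xL) => h1 h2 [].
  rewrite /= in h1 h2; lra.
apply: le_measure; rewrite ?inE//.
  by apply: measurableU => //; exact: measurableD.
move=> x [/= xK|[/= xL _]].
  by have := KLU _ _ xK Ll; rewrite subrK.
by have := KLU _ _ Kk xL; rewrite addrC subrK.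
Qed.

(** By inner regularity the measures of [S] and [T] are suprema over compact
subsets. Adjoining a point of [S] and a point of [T] makes these subsets
nonempty. *)
Lemma lebesgue_measure_sumset (S T U : set R) :
  measurable S -> measurable T -> measurable U -> S !=set0 -> T !=set0 ->
  (forall x y, S x -> T y -> U (x + y)%R) -> lam S + lam T <= lam U.
Proof.
move=> mS mT mU [s Ss] [t Tt] STU.
have key (K L : set R) : compact K -> K `<=` S -> compact L -> L `<=` T ->
    lam K + lam L <= lam U.
  move=> cK KS cL LT.
  have cK' : compact (K `|` [set s]) by apply: compactU => //; exact: compact_set1.
  have cL' : compact (L `|` [set t]) by apply: compactU => //; exact: compact_set1.
  have lK : lam K <= lam (K `|` [set s]).
    by apply: le_measure; rewrite ?inE; [exact: compact_measurable|exact: compact_measurable|exact: subsetUl].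
  have lL : lam L <= lam (L `|` [set t]).
    by apply: le_measure; rewrite ?inE; [exact: compact_measurable|exact: compact_measurable|exact: subsetUl].
  apply: (le_trans (leeD lK lL)); apply: sumset_compact => //.
  - by exists s; right.
  - by exists t; right.
  by move=> x y [xK|->] [yL|->]; apply: STU => //; [exact: KS|exact: LT|exact: KS|exact: LT].
rewrite (lebesgue_regularity_inner_sup mS) (lebesgue_regularity_inner_sup mT).
set a := ereal_sup _; set b := ereal_sup _.
have a0 : 0 <= a.
  by apply: ereal_sup_ubound; exists set0 => //; split => //; exact: compact0.
have b0 : 0 <= b.
  by apply: ereal_sup_ubound; exists set0 => //; split => //; exact: compact0.
have [->|Ufin] := eqVneq (lam U) +oo; first by rewrite leey.
have Uf : lam U \is a fin_num by rewrite ge0_fin_numE// ltey.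
have fc (K : set R) : compact K -> lam K \is a fin_num.
  by move=> cK; rewrite ge0_fin_numE//; exact: compact_finite_measure.
have aK (L : set R) : compact L -> L `<=` T -> a <= lam U - lam L.
  move=> cL LT; apply: ge_ereal_sup => _ [K [cK KS] <-].
  by rewrite leeBrDr ?fc//; exact: key.
have af : a \is a fin_num.
  rewrite ge0_fin_numE//; apply: (le_lt_trans (aK set0 compact0 _)) => //.
  by rewrite measure0 sube0 ltey.
rewrite addeC -leeBrDr//; apply: ge_ereal_sup => _ [L [cL LT] <-].
rewrite leeBrDr// addeC -leeBrDr ?fc//; exact: aK.
Qed.

End line.

(** * Layer cake formula on the line *)

Section layer_cake.
Context {R : realType}.
Local Notation lam := (@lebesgue_measure R).
Variables (f : measurableTypeR R -> \bar R) (c : R).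
Hypotheses (mf : measurable_fun setT f) (f0 : forall s, 0 <= f s) (c0 : (0 < c)%R).

(** The part of the region below the graph of [f / c] that lies at heights in
]0, 1[. Its sections at fixed height are the superlevel sets of [f]. *)
Definition subgraph : set (measurableTypeR R * measurableTypeR R) :=
  [set z | [/\ (0 < z.2)%R, (z.2 < 1)%R & (z.2 * c)%:E <= f z.1]].

Lemma measurable_subgraph : measurable subgraph.
Proof.
rewrite (_ : subgraph = (setT `*` `]0%R, 1%R[%classic) `&`
   (setT `&` [set z | 0 <= f z.1 - (z.2 * c)%:E])); last first.
  apply/seteqP; split=> -[s t] /=; rewrite in_itv/= EFinN sube_ge0 ?orbT//.
    by move=> [/= -> -> ->].
  by move=> [[_ /andP[t0 t1]] [_ tf]]; split.
apply: measurableI; first exact: measurableX.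
apply: emeasurable_fun_c_infty => //; apply: emeasurable_funB.
  exact: measurableT_comp.
apply/measurable_EFinP; apply: measurable_funM => //.
Qed.

Lemma ysection_subgraph t : (0 < t < 1)%R -> ysection subgraph t = [set s | (t * c)%:E <= f s].
Proof.
move=> /andP[t0 t1]; apply/seteqP; split => s; rewrite /ysection /= inE /subgraph /=.
  by case.
by [].
Qed.

Lemma xsection_subgraph s : xsection subgraph s = [set t : R | (0 < t < 1)%R /\ (t * c)%:E <= f s].
Proof.
apply/seteqP; split => t; rewrite /xsection /= inE /subgraph /=.
  by move=> [-> -> ->].
by move=> [/andP[-> ->] ->].
Qed.

Lemma subgraph_tonelli : \int[lam]_s lam (xsection subgraph s) = \int[lam]_t lam (ysection subgraph t).
Proof.
have := indic_fubini_tonelli lam lam measurable_subgraph.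
by rewrite (indic_fubini_tonelli_FE lam measurable_subgraph)
  (indic_fubini_tonelli_GE lam measurable_subgraph).
Qed.

Lemma integral_levels : \int[lam]_(t in `]0%R, 1%R[) lam [set s | (t * c)%:E <= f s] =
  \int[lam]_t lam (ysection subgraph t).
Proof.
rewrite [RHS](_ : _ = \int[lam]_(t in `]0%R, 1%R[) lam (ysection subgraph t)).
  apply: eq_integral => t; rewrite inE /= in_itv /= => t01.
  by rewrite ysection_subgraph.
rewrite [RHS]integral_mkcond; apply: eq_integral => t _; rewrite patchE.
case: ifPn => //; rewrite notin_setE /= in_itv/= => t01.
rewrite (_ : ysection _ _ = set0) ?measure0//.
apply/seteqP; split => // s; rewrite /ysection /= inE /subgraph /= => -[h1 h2 _].
by apply: t01; rewrite h1 h2.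
Qed.

Lemma measurable_levels : measurable_fun (`]0%R, 1%R[%classic : set (measurableTypeR R))
  ((fun t => lam [set s | (t * c)%:E <= f s]) : measurableTypeR R -> \bar R).
Proof.
apply: (eq_measurable_fun (fun t => lam (ysection subgraph t))).
  by move=> t; rewrite inE /= in_itv /= => t01; rewrite ysection_subgraph.
apply: measurable_funTS; exact: (measurable_fun_ysection lam measurable_subgraph).
Qed.

Lemma measurable_fun_xsection_subgraph : measurable_fun setT (fun s => lam (xsection subgraph s)).
Proof. exact: (measurable_fun_xsection lam measurable_subgraph). Qed.

(** The vertical section of the subgraph at [s] has length
[min 1 (f s / c)], so Tonelli's theorem turns the average over the levels
[t * c] into the integral of [min c f]. *)
Lemma integral_ge_levels :
  c%:E * \int[lam]_(t in `]0%R, 1%R[) lam [set s | (t * c)%:E <= f s] <=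
  \int[lam]_s f s.
Proof.
have mxs := measurable_fun_xsection_subgraph.
rewrite integral_levels -subgraph_tonelli -ge0_integralZl//; last by rewrite lee_fin ltW.
apply: ge0_le_integral => //.
- by move=> s _; rewrite mule_ge0// lee_fin ltW.
- exact: measurable_funeM.
move=> s _; rewrite xsection_subgraph.
have : 0 <= f s by exact: f0.
case: (f s) => [r| |//] r0; last by rewrite leey.
apply: (@le_trans _ _ (c%:E * lam `]0%R, (r / c)%R]%classic)).
  rewrite lee_wpmul2l ?lee_fin ?(ltW c0)//.
  apply: le_outer_measure => t /= [/andP[t0 _]].
  by rewrite lee_fin in_itv/= t0 ler_pdivlMr.
rewrite lebesgue_measure_itv /= lte_fin; case: ifPn => _; last by rewrite mule0.
by rewrite oppr0 adde0 -EFinM lee_fin mulrC divfK ?gt_eqF.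
Qed.

Lemma integral_le_levels : (forall s, f s <= c%:E) -> \int[lam]_s f s <=
  c%:E * \int[lam]_(t in `]0%R, 1%R[) lam [set s | (t * c)%:E <= f s].
Proof.
have mxs := measurable_fun_xsection_subgraph.
move=> fc; rewrite integral_levels -subgraph_tonelli -ge0_integralZl//; last by rewrite lee_fin ltW.
apply: ge0_le_integral => //.
- exact: measurable_funeM.
move=> s _; rewrite xsection_subgraph.
have := fc s; have : 0 <= f s by exact: f0.
case: (f s) => [r| |//] //; rewrite !lee_fin => r0 rc.
apply: (@le_trans _ _ (c%:E * lam `]0%R, (r / c)%R[%classic)).
  rewrite lebesgue_measure_itv /= lte_fin; case: ifPn => [_|].
    by rewrite oppr0 adde0 -EFinM lee_fin mulrC divfK ?gt_eqF.
  by rewrite -leNgt ler_pdivrMr// mul0r mule0 lee_fin.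
rewrite lee_wpmul2l ?lee_fin ?(ltW c0)//.
apply: le_outer_measure => t /=.
rewrite in_itv/= => /andP[t0 trc].
have := trc; rewrite ltr_pdivlMr// => tcr.
rewrite t0 /= lee_fin; split; last exact: ltW.
by rewrite (lt_le_trans trc)// ler_pdivrMr// mul1r.
Qed.

End layer_cake.

(** * Slices and the Brunn-Minkowski inequality *)

Definition coord_bounded (R : realType) n (M : R) (A : set 'rV[R]_n) :=
  forall v, A v -> forall i, (`|v ord0 i| <= M)%R.

Section slices.
Context {R : realType} (n : nat).
Local Notation lam := (@lebesgue_measure R).

Definition slice (A : set 'rV[R]_n.+1) (s : R) : set 'rV[R]_n :=
  [set v | A (consR (s, v))].

Lemma xsection_slice A s : xsection (@consR R n @^-1` A) s = slice A s.
Proof. by apply/seteqP; split => v; rewrite /xsection /slice /= inE. Qed.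

Lemma measurable_preimage_consR (A : set 'rV[R]_n.+1) : measurable A ->
  measurable (@consR R n @^-1` A).
Proof. by move=> mA; rewrite -[X in measurable X]setTI; exact: measurable_consR. Qed.

Lemma measurable_slice A s : measurable A -> measurable (slice A s).
Proof.
move=> mA; rewrite -xsection_slice; apply: measurable_xsection.
exact: measurable_preimage_consR.
Qed.

Lemma measurable_fun_slice A : measurable A ->
  measurable_fun [set: measurableTypeR R] (fun s => lebesgue_rV R n (slice A s)).
Proof.
move=> mA.
have := measurable_fun_xsection (lebesgue_rV R n) (measurable_preimage_consR mA).
by apply: eq_measurable_fun => s _; rewrite /= xsection_slice.
Qed.

Lemma lebesgue_rV_slice A :
  lebesgue_rV R n.+1 A = \int[lam]_s lebesgue_rV R n (slice A s).
Proof.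
by apply: eq_integral => s _ /=; rewrite xsection_slice.
Qed.

Lemma consRD (s t : R) (v w : 'rV[R]_n) :
  consR (s + t, v + w)%R = (consR (s, v) + consR (t, w))%R.
Proof.
rewrite /consR /= add_row_mx; congr (row_mx _ _).
by apply/rowP => i; rewrite !mxE.
Qed.

Lemma consR_head (s : R) (v : 'rV[R]_n) :
  (consR (s, v) : 'rV[R]_n.+1) ord0 (lshift n (ord0 : 'I_1)) = s.
Proof. by apply: etrans (row_mxEl (const_mx s) v ord0 ord0) _; rewrite mxE. Qed.

Lemma consR_tail (s : R) (v : 'rV[R]_n) i :
  (consR (s, v) : 'rV[R]_n.+1) ord0 (rshift 1 i) = v ord0 i.
Proof. exact: (row_mxEr (const_mx s) v ord0 i). Qed.

Lemma coord_bounded_slice M A s : coord_bounded M A -> coord_bounded M (slice A s).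
Proof.
by move=> AM v Av i; have := AM _ Av (rshift 1 i); rewrite consR_tail.
Qed.

Lemma slice_eq0 M A s : coord_bounded M A -> (M < `|s|)%R -> slice A s = set0.
Proof.
move=> AM Ms; apply/seteqP; split => // v Av.
have := AM _ Av (lshift n (ord0 : 'I_1)); by rewrite consR_head leNgt Ms.
Qed.

End slices.

Lemma lebesgue_rV_bounded (R : realType) n (M : R) (A : set 'rV[R]_n) :
  (0 <= M)%R -> measurable A -> coord_bounded M A ->
  lebesgue_rV R n A <= ((M *+ 2) ^+ n)%:E.
Proof.
move=> M0; elim: n A => [|n IHn] A mA AM.
  by rewrite expr0 /= diracE; case: (_ \in _); rewrite lee_fin.
rewrite lebesgue_rV_slice.
apply: (@le_trans _ _ (\int[@lebesgue_measure R]_(s in `[(- M)%R, M]%classic) ((M *+ 2) ^+ n)%:E)).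
  rewrite [leRHS]integral_mkcond; apply: ge0_le_integral => //.
  - exact: measurable_fun_slice.
  - by apply/(measurable_restrictT _ _).1 => //; exact: measurable_itv.
  move=> s _; rewrite patchE mem_setE in_itv /= -ler_norml; case: (leP `|s|%R M) => Ms.
    by apply: IHn; [exact: measurable_slice|exact: coord_bounded_slice].
  by rewrite (slice_eq0 AM Ms) measure0; exact: lexx.
rewrite integral_cst; last exact: measurable_itv.
rewrite /= lebesgue_measure_itv /= lte_fin.
case: ifP => _; last by rewrite mule0 lee_fin exprn_ge0// mulrn_wge0.
by rewrite -EFinD -EFinM lee_fin opprK exprS mulrC mulr2n.
Qed.

Lemma exists_root (R : realType) (a : R) n : (0 < a)%R -> (0 < n)%N ->
  exists2 x : R, (0 < x)%R & (x ^+ n = a)%R.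
Proof.
move=> a0 n0; exists (a `^ n%:R^-1)%R; first exact: powR_gt0.
by rewrite -powR_mulrn ?powR_ge0// -powRrM mulVf ?powRr1 ?ltW// pnatr_eq0 -lt0n.
Qed.

Lemma lebesgue_rV0 (R : realType) (A : set 'rV[R]_0) :
  0 < lebesgue_rV R 0 A -> lebesgue_rV R 0 A = 1.
Proof. by rewrite /= diracE; case: (_ \in _) => //=; rewrite ltxx. Qed.

Lemma lebesgue_rV0_mem (R : realType) (A : set 'rV[R]_0) :
  0 < lebesgue_rV R 0 A -> A 0%R.
Proof. by rewrite /= diracE; case: (boolP (_ \in A)) => [/set_mem//|_]; rewrite ltxx. Qed.

(** Writing the supremum of the slice measures as [x ^+ n] turns [x] into a
linear size, which is what adds up in Brunn-Minkowski. In dimension zero every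
power is 1, and the supremum is indeed 1, because slices are empty or a point. *)
Lemma slice_sup (R : realType) n (M : R) (A : set 'rV[R]_n.+1) : (0 <= M)%R ->
  measurable A -> coord_bounded M A -> 0 < lebesgue_rV R n.+1 A ->
  exists2 x : R, (0 < x)%R &
   (forall s, lebesgue_rV R n (slice A s) <= (x ^+ n)%:E) /\
   (forall t, (0 < t < 1)%R -> exists s, (t * x ^+ n)%:E <= lebesgue_rV R n (slice A s)).
Proof.
move=> M0 mA AM A0.
have [s0 s0gt] : exists s, 0 < lebesgue_rV R n (slice A s).
  apply/not_existsP => h; move: A0; rewrite lebesgue_rV_slice integral0_eq ?ltxx//.
  move=> s _; apply/eqP; rewrite eq_le measure_ge0 andbT leNgt.
  by apply/negP; exact: h.
case: n A mA AM A0 s0 s0gt => [|n] A mA AM A0 s0 s0gt.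
  exists 1%R => //; split => [s|t /andP[t0 t1]].
    by rewrite expr0 /= diracE; case: (_ \in _); rewrite lee_fin.
  by exists s0; rewrite lebesgue_rV0// mulr1 lee_fin ltW.
pose a := ereal_sup (range (fun s => lebesgue_rV R n.+1 (slice A s))).
have aub s : lebesgue_rV R n.+1 (slice A s) <= a.
  by apply: ereal_sup_ubound; exists s.
have a0 : 0 < a by exact: lt_le_trans (aub s0).
have afin : a \is a fin_num.
  rewrite ge0_fin_numE ?(ltW a0)//; apply: (@le_lt_trans _ _ ((M *+ 2) ^+ n.+1)%:E).
    apply: ge_ereal_sup => _ [s _ <-].
    by apply: lebesgue_rV_bounded => //; [exact: measurable_slice|exact: coord_bounded_slice].
  exact: ltry.
have fa0 : (0 < fine a)%R by rewrite fine_gt0// a0 ltey_eq afin.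
have [x x0 xa] := exists_root fa0 (ltn0Sn n).
exists x => //; rewrite xa fineK//; split=> // t /andP[t0 t1].
have /ereal_sup_gt[_ [s _ <-] ts] : (t * fine a)%:E < a.
  by rewrite -[ltRHS]fineK// lte_fin gtr_pMl.
by exists s; exact: ltW.
Qed.

(** Stated with lower bounds [p], [q] on the [n]-th roots of the measures, so that
the case [n = 0] makes sense and starts the induction. For the step, [x] and [y]
are the suprema of the sizes of the slices of [A] and [B]. Slices of [A] and [B] of measure
at least [t * x ^+ n] and [t * y ^+ n] produce a slice of [C] of measure at least
[t * (x + y) ^+ n]. Hence the superlevel sets of the slice measures satisfy the
one-dimensional inequality for each [t] in ]0, 1[, and integrating in [t] recovers the
measures of [A], [B] and [C]. *)
Theorem brunn_minkowski (R : realType) n (M : R) (A B C : set 'rV[R]_n) (p q : R) :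
  (0 <= M)%R -> measurable A -> measurable B -> measurable C ->
  coord_bounded M A -> coord_bounded M B ->
  (forall v w, A v -> B w -> C (v + w)%R) -> (0 < p)%R -> (0 < q)%R ->
  (p ^+ n)%:E <= lebesgue_rV R n A -> (q ^+ n)%:E <= lebesgue_rV R n B ->
  ((p + q) ^+ n)%:E <= lebesgue_rV R n C.
Proof.
move=> M0; elim: n A B C p q => [|n IHn] A B C p q mA mB mC AM BM ABC p0 q0 pA qB.
  have A1 : A 0%R.
    by apply: lebesgue_rV0_mem; apply: lt_le_trans pA; rewrite expr0.
  have B1 : B 0%R.
    by apply: lebesgue_rV0_mem; apply: lt_le_trans qB; rewrite expr0.
  by rewrite /= diracE mem_set//; have := ABC _ _ A1 B1; rewrite addr0.
have A0 : 0 < lebesgue_rV R n.+1 A by apply: lt_le_trans pA; rewrite lte_fin exprn_gt0.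
have B0 : 0 < lebesgue_rV R n.+1 B by apply: lt_le_trans qB; rewrite lte_fin exprn_gt0.
have [x x0 [Ax Ax1]] := slice_sup M0 mA AM A0.
have [y y0 [By By1]] := slice_sup M0 mB BM B0.
have xy0 : (0 < x + y)%R by exact: addr_gt0.
pose mu D (s : measurableTypeR R) := lebesgue_rV R n (slice D s).
have mumeas D : measurable D -> measurable_fun setT (mu D) by exact: measurable_fun_slice.
have mu0 D s : 0 <= mu D s by exact: measure_ge0.
have level_sum t s1 s2 : (0 < t < 1)%R -> (t * x ^+ n)%:E <= mu A s1 ->
    (t * y ^+ n)%:E <= mu B s2 -> (t * (x + y) ^+ n)%:E <= mu C (s1 + s2)%R.
  rewrite /mu => /andP[t0 t1] h1 h2; clear mu mumeas mu0.
  case: n IHn A B C mA mB mC AM BM ABC pA qB A0 B0 Ax Ax1 By By1 h1 h2.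
    move=> IHn A B C mA mB mC _ _ ABC _ _ _ _ _ _ _ _ h1 h2.
    rewrite !expr0 !mulr1 in h1 h2 *.
    apply: (@le_trans _ _ 1); first by rewrite lee_fin ltW.
    have t0e : 0 < t%:E by rewrite lte_fin.
    have hA := @lebesgue_rV0 _ _ (lt_le_trans t0e h1).
    have hB := @lebesgue_rV0 _ _ (lt_le_trans t0e h2).
    rewrite -(expr0 (1 + 1)%R); apply: (IHn (slice A s1) (slice B s2)) => //.
    - exact: measurable_slice.
    - exact: measurable_slice.
    - exact: measurable_slice.
    - by move=> v _ [].
    - by move=> v _ [].
    - by move=> v w Av Bw; rewrite /slice /= consRD; exact: ABC.
    - by rewrite expr0 hA.
    - by rewrite expr0 hB.
  move=> n' IHn A B C mA mB mC AM BM ABC _ _ _ _ _ _ _ _ h1 h2.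
  (* the factor t is absorbed into the sizes x and y as its n-th root *)
  have [r r0 rt] := exists_root t0 (ltn0Sn n').
  rewrite -rt -exprMn mulrDr.
  apply: (IHn (slice A s1) (slice B s2)) => //; rewrite ?mulr_gt0//.
  - exact: measurable_slice.
  - exact: measurable_slice.
  - exact: measurable_slice.
  - exact: coord_bounded_slice.
  - exact: coord_bounded_slice.
  - by move=> v w Av Bw; rewrite /slice /= consRD; exact: ABC.
  - by rewrite exprMn rt.
  - by rewrite exprMn rt.
pose lev D c (t : measurableTypeR R) := lebesgue_measure [set s | (t * c)%:E <= mu D s].
have xn0 : (0 < x ^+ n)%R by rewrite exprn_gt0.
have yn0 : (0 < y ^+ n)%R by rewrite exprn_gt0.
have xyn0 : (0 < (x + y) ^+ n)%R by rewrite exprn_gt0.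
have mlev D c : measurable D -> (0 < c)%R ->
    measurable_fun (`]0%R, 1%R[%classic : set (measurableTypeR R)) (lev D c).
  by move=> mD c0; apply: measurable_levels => //; exact: mumeas.
have mset D c t : measurable D -> measurable [set s : measurableTypeR R | (t * c)%:E <= mu D s].
  move=> mD; rewrite -[X in measurable X]setTI.
  by apply: emeasurable_fun_c_infty => //; exact: mumeas.
rewrite lebesgue_rV_slice.
apply: (le_trans _ (integral_ge_levels (mumeas _ mC) (mu0 C) xyn0)).
pose I D c := \int[@lebesgue_measure R]_(t in `]0%R, 1%R[%classic) lev D c t.
have IA : ((p ^+ n.+1) / x ^+ n)%:E <= I A (x ^+ n)%R.
  rewrite -(@lee_pmul2l _ (x ^+ n)%:E)// -EFinM mulrC divfK ?gt_eqF//.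
  apply: (le_trans pA); rewrite lebesgue_rV_slice.
  exact: (integral_le_levels (mumeas _ mA) (mu0 A) xn0 Ax).
have IB : ((q ^+ n.+1) / y ^+ n)%:E <= I B (y ^+ n)%R.
  rewrite -(@lee_pmul2l _ (y ^+ n)%:E)// -EFinM mulrC divfK ?gt_eqF//.
  apply: (le_trans qB); rewrite lebesgue_rV_slice.
  exact: (integral_le_levels (mumeas _ mB) (mu0 B) yn0 By).
apply: (@le_trans _ _ (((x + y) ^+ n)%:E * (I A (x ^+ n)%R + I B (y ^+ n)%R))).
  apply: (le_trans _ (lee_wpmul2l _ (leeD IA IB))); last by rewrite lee_fin ltW.
  by rewrite -EFinD -EFinM lee_fin power_mean_two.
rewrite lee_pmul2l; last 2 first.
  by rewrite fin_numE.
  by rewrite lte_fin.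
rewrite /I -ge0_integralD; last 5 first.
  exact: measurable_itv.
  by move=> t _; exact: measure_ge0.
  exact: mlev.
  by move=> t _; exact: measure_ge0.
  exact: mlev.
apply: ge0_le_integral => //.
- by move=> t _; rewrite adde_ge0.
- by apply: emeasurable_funD; exact: mlev.
- exact: mlev.
move=> t; rewrite /= in_itv /= => t01.
apply: lebesgue_measure_sumset; [exact: mset|exact: mset|exact: mset| | |].
- by have [s] := Ax1 _ t01; exists s.
- by have [s] := By1 _ t01; exists s.
by move=> s1 s2; exact: level_sum.
Qed.

(** * Borel sets, scaling and cubes *)

Section borel_open.
Context {R : realType} (n : nat).

Lemma measurable_coord_preimage (i : 'I_n) (Y : set R) :
  measurable (Y : set (measurableTypeR R)) ->
  measurable [set v : 'rV[R]_n | Y (v ord0 i)].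
Proof.
by move=> mY; have := measurable_rV_coord i measurableT mY; rewrite setTI.
Qed.

Lemma measurable_forall_coord (P : 'I_n -> set R) :
  (forall i, measurable (P i : set (measurableTypeR R))) ->
  measurable [set v : 'rV[R]_n | forall i, P i (v ord0 i)].
Proof.
move=> mP; rewrite (_ : [set _ | _] =
    \bigcap_(i in [set: 'I_n]) [set v : 'rV[R]_n | P i (v ord0 i)]); last first.
  by apply/seteqP; split=> v /= Pv i; [move=> _|]; exact: Pv.
apply: fin_bigcap_measurable => //.
by move=> i _; exact: measurable_coord_preimage.
Qed.

(** The sigma-algebra is generated by the coordinates, so an open set is written as
the countable union of the rational boxes that it contains. *)
Lemma open_measurable_rV (A : set 'rV[R]_n) : open A -> measurable A.
Proof.
move=> oA.
pose box (qk : 'rV[rat]_n * nat) : set 'rV[R]_n :=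
  [set v | forall i, `|v ord0 i - ratr (qk.1 ord0 i)| < qk.2.+1%:R^-1]%R.
rewrite (_ : A = \bigcup_(qk in [set: 'rV[rat]_n * nat])
    (if `[< box qk `<=` A >] then box qk else set0)); last first.
  apply/seteqP; split => [v Av|v [qk _]]; last by case: asboolP => // + vb; exact.
  move: oA; rewrite openE => /(_ _ Av) /nbhs_ballP[e /= e0 veA].
  have [k ke] : exists k : nat, (k.+1%:R^-1 < e / 2)%R.
    have e20 : (0 < e / 2)%R by rewrite divr_gt0.
    by have [k _ /(_ k (leqnn k)) kP] := near_infty_natSinv_lt (PosNum e20); exists k.
  have k0 : (0 < k.+1%:R^-1 :> R)%R by rewrite invr_gt0.
  set d := (k.+1%:R^-1 : R)%R in ke k0.
  have qi i : exists q : rat, (`|v ord0 i - ratr q| < d)%R.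
    have vlt : (v ord0 i - d < v ord0 i + d)%R by lra.
    have [q] := rat_in_itvoo vlt; rewrite in_itv /= => /andP[q1 q2].
    by exists q; rewrite distrC ltr_distl q1 q2.
  have [q qv] := choice qi.
  exists (\row_i q i, k) => //; case: asboolP => [_ i|].
    by rewrite mxE.
  case=> w wb; apply: veA; rewrite -ball_normE /=.
  rewrite [ltLHS]/normr /= mx_normrE; apply/bigmax_ltP; split => // -[a i] _ /=.
  rewrite (ord1 a) !mxE /=.
  have := wb i; have := qv i; rewrite /= mxE -/d => h1 h2.
  rewrite (_ : _ - _ = (v ord0 i - ratr (q i)) - (w ord0 i - ratr (q i)))%R; last by ring.
  by apply: (le_lt_trans (ler_normB _ _)); lra.
apply: countable_bigcupT_measurable; first exact: countableP.
move=> qk; case: asboolP => // _.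
apply: (measurable_forall_coord (P := fun i => [set x | `|x - ratr (qk.1 ord0 i)| < qk.2.+1%:R^-1]%R)) => i.
rewrite (_ : [set _ | _] = ball (ratr (qk.1 ord0 i) : R) (qk.2.+1%:R^-1)); first exact: measurable_ball.
by rewrite -ball_normE; apply/seteqP; split => x /=; rewrite distrC.
Qed.

End borel_open.

Section scaling.
Context {R : realType}.
Local Notation lam := (@lebesgue_measure R).

Lemma measurable_mulrl (c : R) :
  measurable_fun setT ((fun x => c * x)%R : measurableTypeR R -> measurableTypeR R).
Proof. exact: mulrl_measurable. Qed.

(** On the line, [c] times the image of the Lebesgue measure by [s |-> c * s] is
the Lebesgue measure. *)
Lemma integral_scale (c : R) (f : measurableTypeR R -> \bar R) : (0 < c)%R ->
  measurable_fun setT f -> (forall s, 0 <= f s) ->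
  \int[lam]_s f s = c%:E * \int[lam]_s f (c * s)%R.
Proof.
move=> c0 mf f0.
rewrite -(@ge0_integral_pushforward _ _ _ _ _ _ (measurable_mulrl c) lam setT f) //.
rewrite -(ge0_integral_mscale _ _ (NngNum (ltW c0)))//; first exact: measurable_mulrl.
move=> mc; apply: eq_measure_integral => A mA _.
apply: (etrans (lebesgue_measure_affine 0 c0 mA)); rewrite /mscale /= /pushforward.
by congr (_ * lam _); apply/seteqP; split => x /=; rewrite addr0.
Qed.

Lemma measurable_scale_preimage n (c : R) (A : set 'rV[R]_n) : measurable A ->
  measurable [set v | A (c *: v)%R].
Proof.
move=> mA.
have mf : measurable_fun setT (fun v : 'rV[R]_n => c *: v)%R.
  apply: measurable_fun_rV => i.
  rewrite (_ : _ \o _ = (fun x : measurableTypeR R => c * x : measurableTypeR R)%R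
    \o @rV_coord R n i); last by apply/funext => v; rewrite /= /rV_coord mxE.
  by apply: measurableT_comp; [exact: measurable_mulrl|exact: measurable_rV_coord].
by have := mf measurableT _ mA; rewrite setTI.
Qed.

(** Each coordinate contributes one factor [c]: the induction slices [A] and
rescales the first coordinate. *)
Lemma lebesgue_rV_scale n (c : R) (A : set 'rV[R]_n) : (0 < c)%R -> measurable A ->
  lebesgue_rV R n A = (c ^+ n)%:E * lebesgue_rV R n [set v | A (c *: v)%R].
Proof.
move=> c0; elim: n A => [|n IHn] A mA.
  rewrite expr0 mul1e; congr (lebesgue_rV _ _ _).
  by apply/seteqP; split => v /=; rewrite (_ : c *: v = v)%R//; apply/rowP => -[].
rewrite !lebesgue_rV_slice.
rewrite (integral_scale c0); [|exact: measurable_fun_slice|by move=> s; exact: measure_ge0].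
rewrite exprS EFinM -muleA; congr (_ * _).
rewrite -ge0_integralZl//=; last 2 first.
- by apply: measurable_fun_slice; exact: measurable_scale_preimage.
- by rewrite lee_fin exprn_ge0// ltW.
apply: eq_integral => s _; rewrite IHn; last exact: measurable_slice.
congr (_ * lebesgue_rV _ _ _); apply/seteqP.
have cE v : (c *: consR (s, v) = consR (c * s, c *: v) :> 'rV[R]_n.+1)%R.
  apply/rowP => i; rewrite mxE; case: (split_ordP (i : 'I_(1 + n))) => j ->.
    by rewrite (ord1 j) !consR_head.
  by rewrite !consR_tail mxE.
by split => v; rewrite /slice /= cE.
Qed.

Definition cube n (r : R) : set 'rV[R]_n := [set v | forall i, `|v ord0 i| < r]%R.
Arguments cube n r : clear implicits.

Lemma lebesgue_rV_cube n (r : R) : (0 < r)%R ->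
  lebesgue_rV R n (cube n r) = ((r *+ 2) ^+ n)%:E.
Proof.
move=> r0; elim: n => [|n IHn].
  by rewrite expr0 /= diracE mem_set// => -[].
rewrite lebesgue_rV_slice.
transitivity (\int[lam]_(s in `](- r)%R, r[%classic) ((r *+ 2) ^+ n)%:E).
  rewrite [RHS]integral_mkcond; apply: eq_integral => s _.
  rewrite patchE mem_setE in_itv /= -ltr_norml.
  have sl v : cube n.+1 r (consR (s, v)) <-> (`|s| < r)%R /\ cube n r v.
    split=> [cv|[sr vr] i].
      split; first by have := cv (lshift n (ord0 : 'I_1)); rewrite consR_head.
      by move=> i; have := cv (rshift 1 i); rewrite consR_tail.
    by case: (split_ordP (i : 'I_(1 + n))) => j ->; rewrite ?(ord1 j) ?consR_head ?consR_tail.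
  case: ltP => sr.
    rewrite -IHn; congr (lebesgue_rV _ _ _); apply/seteqP.
    by split=> v; rewrite /slice /= sl => //; case.
  rewrite (_ : slice _ _ = set0) ?measure0//.
  apply/seteqP; split => // v; rewrite /slice /= sl => -[].
  by rewrite ltNge sr.
rewrite integral_cst; last exact: measurable_itv.
rewrite /= lebesgue_measure_itv /= lte_fin.
rewrite ifT; last by lra.
by rewrite -EFinD -EFinM opprK exprS mulrC mulr2n.
Qed.

End scaling.
Arguments cube {R} n r.

(** * Euclidean norm and balls *)

Lemma continuous_bigsum (R : realType) (T : topologicalType) (I : Type) (r : seq I)
    (F : I -> T -> R) : (forall i, continuous (F i)) ->
  continuous (fun v => \sum_(i <- r) F i v)%R.
Proof.
move=> cF; elim: r => [|i r IHr] v.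
  rewrite (_ : (fun _ => _) = cst 0%R); first exact: cst_continuous.
  by apply/funext => u; rewrite big_nil.
rewrite (_ : (fun _ => _) = (F i \+ (fun u => \sum_(i <- r) F i u))%R).
  by apply: continuousD; [exact: cF|exact: IHr].
by apply/funext => u; rewrite big_cons.
Qed.

Section euclidean_norm.
Context {R : realType} (n : nat).
Implicit Types v w : 'rV[R]_n.

Lemma enorm_ge0 v : (0 <= enorm v)%R.
Proof. exact: sqrtr_ge0. Qed.

Lemma sqr_enorm v : (enorm v ^+ 2 = \sum_(i < n) v ord0 i ^+ 2)%R.
Proof. by rewrite sqr_sqrtr// sumr_ge0// => i _; exact: sqr_ge0. Qed.

Lemma coord_le_enorm v i : (`|v ord0 i| <= enorm v)%R.
Proof.
rewrite -(@ler_pXn2r _ 2) ?nnegrE ?enorm_ge0// sqr_enorm.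
rewrite -normrX ger0_norm ?sqr_ge0// (bigD1 i)//= lerDl.
by rewrite sumr_ge0// => j _; exact: sqr_ge0.
Qed.

Lemma enorm_mx_norm (v : 'rV[R]_n) : (`|v| <= enorm v)%R.
Proof.
rewrite [leLHS]/normr /= mx_normrE; apply/bigmax_leP; split; first exact: enorm_ge0.
by move=> [a i] _ /=; rewrite (ord1 a) coord_le_enorm.
Qed.

(** The sum of the squares of [|w|^2 v_i - <v, w> w_i] is
[|w|^2 (|v|^2 |w|^2 - <v, w>^2)]. *)
Lemma cauchy_schwarz v w :
  (\sum_(i < n) v ord0 i * w ord0 i <= enorm v * enorm w)%R.
Proof.
set c := (\sum_(i < n) _)%R.
have [w0|] := eqVneq (enorm w) 0%R.
  rewrite /c big1 ?mulr_ge0 ?enorm_ge0// => i _.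
  have := coord_le_enorm w i; rewrite w0 normr_le0 => /eqP ->.
  by rewrite mulr0.
move=> w0; have wgt0 : (0 < enorm w ^+ 2)%R by rewrite exprn_gt0// lt_def w0 enorm_ge0.
have sq : (c ^+ 2 <= (enorm v * enorm w) ^+ 2)%R.
  have : (0 <= \sum_(i < n) (enorm w ^+ 2 * v ord0 i - c * w ord0 i) ^+ 2)%R.
    by rewrite sumr_ge0// => i _; exact: sqr_ge0.
  rewrite (_ : \sum_(i < n) _ = enorm w ^+ 2 * ((enorm v * enorm w) ^+ 2 - c ^+ 2))%R.
    by rewrite pmulr_rge0// subr_ge0.
  rewrite (eq_bigr (fun i => (enorm w ^+ 2) ^+ 2 * v ord0 i ^+ 2
    - (2 * enorm w ^+ 2 * c) * (v ord0 i * w ord0 i) + c ^+ 2 * w ord0 i ^+ 2)%R); last first.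
    by move=> i _; ring.
  rewrite big_split sumrB /= -!mulr_sumr -/c -!sqr_enorm; ring.
have [c0|c0] := leP 0%R c; last first.
  by rewrite (le_trans (ltW c0))// mulr_ge0 ?enorm_ge0.
by rewrite -(@ler_pXn2r _ 2) ?nnegrE ?mulr_ge0 ?enorm_ge0.
Qed.

Lemma enormD v w : (enorm (v + w) <= enorm v + enorm w)%R.
Proof.
rewrite -(@ler_pXn2r _ 2) ?nnegrE ?addr_ge0 ?enorm_ge0// sqr_enorm.
rewrite (eq_bigr (fun i => v ord0 i ^+ 2 + 2 * (v ord0 i * w ord0 i) + w ord0 i ^+ 2)%R); last first.
  by move=> i _; rewrite mxE; ring.
rewrite !big_split /= -mulr_sumr -!sqr_enorm.
by have := cauchy_schwarz v w; lra.
Qed.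

Lemma enormN v : enorm (- v)%R = enorm v.
Proof. by congr Num.sqrt; apply: eq_bigr => i _; rewrite mxE sqrrN. Qed.

Lemma enormZ (c : R) v : (enorm (c *: v) = `|c| * enorm v)%R.
Proof.
rewrite /enorm -sqrtr_sqr -sqrtrM ?sqr_ge0//; congr Num.sqrt.
by rewrite mulr_sumr; apply: eq_bigr => i _; rewrite mxE exprMn.
Qed.

Lemma enorm0 : enorm (0 : 'rV[R]_n)%R = 0%R.
Proof. by rewrite -[in LHS](scale0r (0 : 'rV[R]_n)%R) enormZ normr0 mul0r. Qed.

Lemma enorm_continuous : continuous (@enorm R n).
Proof.
move=> v; apply: (@continuous_comp _ _ _ (fun v => \sum_(i < n) (v ord0 i) ^+ 2)%R Num.sqrt).
  apply: continuous_bigsum => i u.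
  apply: (@continuous_comp _ _ _ (fun v : 'rV[R]_n => v ord0 i) (fun x : R => x ^+ 2)%R).
    exact: coord_continuous.
  exact: exprn_continuous.
exact: sqrt_continuous.
Qed.

Definition eball (r : R) : set 'rV[R]_n := [set v | enorm v < r]%R.

Lemma open_eball r : open (eball r).
Proof.
rewrite (_ : eball r = @enorm R n @^-1` `]-oo, r[%classic).
  by apply: open_comp => // v _; exact: enorm_continuous.
by apply/seteqP; split => v; rewrite /eball /= in_itv.
Qed.

Lemma measurable_eball r : measurable (eball r).
Proof. by apply: open_measurable_rV; exact: open_eball. Qed.

Lemma eball_bounded r : coord_bounded r (eball r).
Proof. by move=> v vr i; rewrite (le_trans (coord_le_enorm _ _))// ltW. Qed.

Lemma lebesgue_rV_eball_scale r : (0 < r)%R ->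
  lebesgue_rV R n (eball r) = (r ^+ n)%:E * lebesgue_rV R n (eball 1).
Proof.
move=> r0; rewrite (lebesgue_rV_scale r0 (measurable_eball r)).
congr (_ * lebesgue_rV _ _ _); apply/seteqP; rewrite /eball.
by split => v /=; rewrite enormZ gtr0_norm// gtr_pMr.
Qed.

(** The ball contains the cube of half-side [1 / (n + 1)]. *)
Lemma lebesgue_rV_eball_gt0 : 0 < lebesgue_rV R n (eball 1).
Proof.
have r0 : (0 < n.+1%:R^-1 :> R)%R by rewrite invr_gt0.
have cube_gt0 : 0 < lebesgue_rV R n (cube n (n.+1%:R^-1)%R).
  by rewrite lebesgue_rV_cube// lte_fin exprn_gt0// mulrn_wgt0.
apply: (lt_le_trans cube_gt0); apply: le_measure; rewrite ?inE; last 2 first.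
- exact: measurable_eball.
- move=> v vc; rewrite /eball /= -(@ltr_pXn2r _ 2) ?nnegrE ?enorm_ge0// sqr_enorm expr1n.
  apply: (@le_lt_trans _ _ (\sum_(i < n) (n.+1%:R^-1 : R)))%R.
    apply: ler_sum => i _; rewrite -real_normK ?num_real// expr2.
    rewrite (le_trans _ (ltW (vc i)))// -[leRHS]mul1r ler_wpM2r//.
    by rewrite (le_trans (ltW (vc i)))// invf_le1// ler1n.
  by rewrite sumr_const card_ord -[ltLHS]mulr_natl ltr_pdivrMr// mul1r ltr_nat.
apply: (measurable_forall_coord (P := fun=> [set x | `|x| < n.+1%:R^-1]%R)) => _.
rewrite (_ : [set _ | _] = ball (0 : R)%R (n.+1%:R^-1)%R); first exact: measurable_ball.
by rewrite -ball_normE; apply/seteqP; split => x /=; rewrite sub0r normrN.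
Qed.

Lemma lebesgue_rV_eball_fin : lebesgue_rV R n (eball 1) \is a fin_num.
Proof.
rewrite ge0_fin_numE ?measure_ge0//.
by rewrite (le_lt_trans (lebesgue_rV_bounded ler01 (measurable_eball 1) (@eball_bounded 1)))// ltry.
Qed.

End euclidean_norm.

(** * Borel sets under the completed measure *)

Section completion.
Context {R : realType} (n : nat).

Notation leb_type := (caratheodory_type ((lebesgue_rV R n)^*)%mu).

Lemma lebnE (A : set 'rV[R]_n) : measurable A -> lebn R n A = lebesgue_rV R n A.
Proof. exact: measurable_mu_extE. Qed.

Lemma measurable_lebn (A : set 'rV[R]_n) : measurable A -> measurable (A : set leb_type).
Proof. exact: caratheodory_measurable_mu_ext. Qed.

(** The completed measure is the outer measure, hence monotone on all sets. *)
Lemma le_lebn (A B : set 'rV[R]_n) : A `<=` B -> lebn R n A <= lebn R n B.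
Proof. exact: le_outer_measure. Qed.

Lemma lebn_open_measurable (A : set 'rV[R]_n) : open A -> measurable (A : set leb_type).
Proof. by move=> oA; apply: measurable_lebn; exact: open_measurable_rV. Qed.

Lemma continuous_lebn_measurable (f : 'rV[R]_n -> R) : continuous f ->
  measurable_fun [set: leb_type] (f : leb_type -> measurableTypeR R).
Proof.
move=> cf; apply: (measurability _ (RGenOpens.measurableE R)) => _ [_ [a [b ->] <-]].
rewrite setTI; apply: lebn_open_measurable; by apply: open_comp => // x _; exact: cf.
Qed.

End completion.

(** * Calculus of test functions *)

(** Near each point of [K] one radius works, by continuity. Compactness makes it
uniform on [K], and two points outside [K] have the same image. *)
Lemma continuous_compact_support_unif (R : realType) n (G : 'rV[R]_n -> R)
    (K : set 'rV[R]_n) : continuous G -> compact K -> (forall x, ~ K x -> G x = 0%R) ->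
  forall e : R, (0 < e)%R -> exists2 d : R, (0 < d)%R &
    forall x y, (`|x - y| < d)%R -> (`|G x - G y| < e)%R.
Proof.
move=> cG cK GK e e0.
have nearK : \forall d \near (0 : R)^'+,
    K `<=` [set x | forall y, (`|x - y| < d)%R -> (`|G x - G y| < e)%R].
  move: cK => /compact_near_coveringP/(_ R ((0 : R)^'+) (fun (d : R) (x : 'rV[R]_n) =>
    forall y, (`|x - y| < d)%R -> (`|G x - G y| < e)%R)); apply => x Kx.
  have e20 : (0 < e / 2)%R by rewrite divr_gt0.
  have /cvgrPdist_lt/(_ _ e20)/nbhs_ballP[r /= r0 xr] := cG x.
  have r20 : (0 < r / 2)%R by rewrite divr_gt0.
  exists (ball x (r / 2), [set d : R | (d < r / 2)%R]) => /=.
    by split; [exact: nbhsx_ballx|exact: nbhs_right_lt].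
  move=> [z d] /= [xz dr] y zy.
  have xz' : (`|x - z| < r / 2)%R by move: xz; rewrite -ball_normE.
  have h1 : (`|G x - G z| < e / 2)%R.
    by apply: xr; rewrite -ball_normE /=; lra.
  have h2 : (`|G x - G y| < e / 2)%R.
    apply: xr; rewrite -ball_normE /=.
    rewrite (_ : x - y = (x - z) + (z - y))%R; last by rewrite addrA subrK.
    by apply: (le_lt_trans (ler_normD _ _)); lra.
  rewrite (_ : G z - G y = (G x - G y) - (G x - G z))%R; last by ring.
  by apply: (le_lt_trans (ler_normB _ _)); lra.
have [d [/= dK d0]] : exists d : R, K `<=` [set x | forall y, (`|x - y| < d)%R -> (`|G x - G y| < e)%R]
    /\ (0 < d)%R.
  have := @filter_ex R ((0 : R)^'+) _ _ (filterI nearK (nbhs_right_gt (0 : R)%R)).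
  by case=> d [h1 h2]; exists d.
exists d => // x y xy.
have [Kx|nKx] := pselect (K x); first exact: dK.
have [Ky|nKy] := pselect (K y); first by rewrite distrC; apply: dK => //; rewrite distrC.
by rewrite (GK _ nKx) (GK _ nKy) subrr normr0.
Qed.

Section first_order_bound.
Context {R : realType} (n : nat) (u : 'rV[R]_n -> R).
Hypothesis du : forall x, differentiable u x.

Lemma diff_partials (x v : 'rV[R]_n) : ('d u x v = \sum_(i < n) v ord0 i * partial i u x)%R.
Proof.
rewrite {1}(row_sum_delta v) linear_sum; apply: eq_bigr => i _.
by rewrite linearZ /= /partial deriveE.
Qed.

(** The derivative of [u] along the segment is a scalar product with the
gradient. *)
Lemma mean_value_enorm (x y : 'rV[R]_n) (C : R) :
  (forall t, (0 <= t <= 1)%R -> enorm (grad u (x + t *: (y - x))) <= C)%R ->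
  (u y - u x <= enorm (y - x) * C)%R.
Proof.
move=> uC; set v := (y - x)%R in uC *.
pose g (t : R) : 'rV[R]_n := (x + t *: v)%R.
have dg t : is_diff t g (fun k => k *: v)%R.
  rewrite (_ : g = cst x + ( *:%R ^~ v))%R; last exact/funext.
  exact: (is_diff_eq (is_diffD (is_diff_cst x t) (is_diff_scalel t v)) (add0r _)).
have fder (t : R) : is_derive t (1%R : R)  (u \o g) ('d u (g t) v).
  have dug : differentiable (u \o g) t by exact: differentiable_comp.
  apply: DeriveDef; first exact: diff_derivable.
  by rewrite deriveE// diff_comp//= diff_val scale1r.
have [|c /[!in_itv]/= c01] := @MVT_segment R (u \o g) (fun t => 'd u (g t) v) 0%R 1%R ler01 (fun t _ => fder t).
  apply: continuous_subspaceT => t; apply: differentiable_continuous.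
  exact: differentiable_comp.
rewrite subr0 mulr1 /g /= scale1r scale0r addr0 [(x + v)%R]addrC subrK => ->.
rewrite diff_partials.
have -> : (\sum_(i < n) v ord0 i * partial i u (x + c *: v) =
           \sum_(i < n) v ord0 i * grad u (x + c *: v) ord0 i)%R.
  by apply: eq_bigr => i _; rewrite [grad _ _ _ _]mxE.
by apply: (le_trans (cauchy_schwarz _ _)); rewrite ler_wpM2l ?enorm_ge0// uC.
Qed.

End first_order_bound.

Section test_function_theory.
Context {R : realType} (n : nat) (Omega : set 'rV[R]_n) (u : 'rV[R]_n -> R).
Hypothesis tu : test_function Omega u.

Lemma test_differentiable x : differentiable u x.
Proof. by case: tu => /(_ [::] x). Qed.

Lemma test_continuous : continuous u.
Proof. by move=> x; apply: differentiable_continuous; exact: test_differentiable. Qed.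

Lemma test_partial_continuous i : continuous (partial i u).
Proof.
by move=> x; apply: differentiable_continuous; case: tu => /(_ [:: i] x).
Qed.

Lemma test_grad_norm_continuous : continuous (fun x => enorm (grad u x)).
Proof.
move=> x; apply: (@continuous_comp _ _ _ (fun v => \sum_(i < n) (grad u v ord0 i) ^+ 2)%R Num.sqrt).
  apply: continuous_bigsum => i v.
  apply: (@continuous_comp _ _ _ (fun v => grad u v ord0 i) (fun x : R => x ^+ 2)%R).
    rewrite (_ : (fun _ => _) = partial i u); first exact: test_partial_continuous.
    by apply/funext => w; rewrite mxE.
  exact: exprn_continuous.
exact: sqrt_continuous.
Qed.

Lemma test_supp0 x : ~ supp u x -> u x = 0%R.
Proof.
by move=> sx; apply/eqP/negPn/negP => ux; apply: sx; exact: subset_closure.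
Qed.

Lemma test_grad0 x : ~ supp u x -> enorm (grad u x) = 0%R.
Proof.
move=> sx; have nx : \near x, u x = cst 0%R x.
  have : open (~` supp u) by rewrite openC; exact: closed_closure.
  rewrite openE => /(_ _ sx); apply: filterS => y; exact: test_supp0.
rewrite (_ : grad u x = 0%R) ?enorm0//.
apply/rowP => i; rewrite !mxE /partial.
by rewrite (near_eq_derive _ nx) derive_cst.
Qed.

Lemma test_supp_compact : compact (supp u).
Proof. by case: tu. Qed.

Lemma test_supp_bounded : exists2 M : R, (0 <= M)%R & coord_bounded M (supp u).
Proof.
have [M [_ Mu]] := compact_bounded test_supp_compact.
exists (`|M| + 1)%R; first by rewrite addr_ge0.
move=> v sv i; have := Mu (`|M| + 1)%R _ v sv.
have M1 : (M < `|M| + 1)%R by rewrite (le_lt_trans (ler_norm M))// ltrDl.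
move=> /(_ M1); apply: le_trans.
rewrite [leRHS]/normr /= mx_normrE; apply/bigmax_geP; right => /=.
by exists (ord0, i) => //=; rewrite lexx.
Qed.

(** The slope between two points is bounded by the gradient at the first one, up to
[eta], uniformly in the points: on the segment the gradient varies by less than
[eta], since it is uniformly continuous. *)
Lemma test_first_order (eta : R) : (0 < eta)%R -> exists2 d : R, (0 < d)%R &
  forall x y, (enorm (y - x) < d)%R ->
    (u y - u x <= enorm (y - x) * (enorm (grad u x) + eta))%R.
Proof.
move=> eta0; have [d d0 ud] := continuous_compact_support_unif
  test_grad_norm_continuous test_supp_compact test_grad0 eta0.
exists d => // x y xyd; apply: (mean_value_enorm test_differentiable) => t /andP[t0 t1].
have : (`|enorm (grad u (x + t *: (y - x))) - enorm (grad u x)| < eta)%R.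
  apply: ud; rewrite addrAC subrr add0r.
  apply: (le_lt_trans (enorm_mx_norm _)); rewrite enormZ ger0_norm//.
  by rewrite (le_lt_trans _ xyd)// ler_piMl// enorm_ge0.
by rewrite ltr_norml => /andP[_ ?]; lra.
Qed.

Lemma test_grad_bounded : exists2 L : R, (0 <= L)%R & forall x, (enorm (grad u x) <= L)%R.
Proof.
have [s0|s0] := pselect (supp u !=set0); last first.
  exists 0%R => // x; rewrite test_grad0// => sx; apply: s0; by exists x.
have [|c _ cmax] := @EVT_max_rV R n (fun x => enorm (grad u x)) _ s0 test_supp_compact.
  by apply: continuous_subspaceT; exact: test_grad_norm_continuous.
exists (enorm (grad u c)); first exact: enorm_ge0.
move=> x; have [sx|sx] := pselect (supp u x); first by apply: cmax; rewrite inE.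
by rewrite test_grad0// enorm_ge0.
Qed.

End test_function_theory.

(** * Integrals of step functions *)

Lemma integral_sum_indic d (T : measurableType d) (R : realType)
    (mu : {measure set T -> \bar R}) N (h : R) (E : nat -> set T) : (0 <= h)%R ->
  (forall i, measurable (E i)) ->
  \int[mu]_x (\sum_(i < N) (h * \1_(E i) x)%R%:E) = \sum_(i < N) h%:E * mu (E i).
Proof.
move=> h0 mE; have mind i : measurable_fun setT (fun x => (\1_(E i) x)%:E : \bar R).
  by apply/measurable_EFinP; exact: measurable_indic.
rewrite ge0_integral_sum; last 3 first.
- exact: measurableT.
- move=> i; apply/measurable_EFinP; exact: measurable_funM.
- by move=> i x _; rewrite lee_fin mulr_ge0.
apply: eq_bigr => i _; under eq_integral do rewrite EFinM.
rewrite ge0_integralZl//.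
by rewrite integral_indic// setIT.
Qed.

Lemma integral_affine_comp d (T : measurableType d) (R : realType)
    (mu : {measure set T -> \bar R}) (D : set T) (G : T -> R) (k c : R) :
  measurable D -> (0 <= k)%R -> (0 <= c)%R -> (forall x, 0 <= G x)%R ->
  measurable_fun D G ->
  \int[mu]_(x in D) (k * (G x + c))%:E =
  k%:E * (\int[mu]_(x in D) (G x)%:E + c%:E * mu D).
Proof.
move=> mD k0 c0 G0 mG; under eq_integral do rewrite EFinM.
rewrite ge0_integralZl//; last 2 first.
- by apply/measurable_EFinP; exact: measurable_funD.
- by move=> x _; rewrite lee_fin addr_ge0.
under eq_integral do rewrite EFinD.
rewrite ge0_integralD//; last 2 first.
- by move=> x _; rewrite lee_fin.
- exact/measurable_EFinP.
by rewrite integral_cst.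
Qed.

(** * Level bound for test functions *)

(** The terms of an arithmetic progression of step [h] that lie in an interval of
length [q - p] number at most [(q - p) / h + 1]. *)
Lemma level_count (R : realFieldType) (h p q s : R) N : (0 < h)%R -> (p <= q)%R ->
  (\sum_(i < N) h * ((p <= s + i%:R * h) && (s + i%:R * h < q))%R%:R <= q - p + h)%R.
Proof.
move=> h0 pq.
(* the terms below s + N * h satisfy this sharper bound, which is inductive *)
suff : (\sum_(i < N) h * ((p <= s + i%:R * h) && (s + i%:R * h < q))%R%:R
    <= Num.max 0 (Num.min (q + h) (s + N%:R * h) - p))%R.
  move=> /le_trans; apply; rewrite ge_max; apply/andP; split; first lra.
  rewrite -addrA [(- p + h)%R]addrC addrA lerD2r.
  by rewrite ge_min lexx.
elim: N => [|N IHN]; first by rewrite big_ord0 le_max lexx.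
rewrite big_ord_recr /=; set S := (\sum_(i < N) _)%R in IHN *.
rewrite -[N.+1%:R]natr1 mulrDl mul1r addrA.
set x := (s + N%:R * h)%R in IHN *.
have [/andP[px xq]|_] := boolP (_ && _).
  rewrite mulr1; apply: (@le_trans _ _ (x - p + h)%R).
    rewrite lerD2r; apply: (le_trans IHN); rewrite ge_max subr_ge0 px /=.
    by rewrite lerD2r ge_min lexx orbT.
  by rewrite le_max; apply/orP; right; rewrite min_r; lra.
rewrite mulr0 addr0; apply: (le_trans IHN); rewrite ge_max !le_max lexx /=.
apply/orP; right; rewrite lerD2r le_min !ge_min lexx /=.
by apply/orP; right; lra.
Qed.

Definition enlarge (R : realType) n (A : set 'rV[R]_n) (r : R) : set 'rV[R]_n :=
  [set x | exists2 y, A y & (enorm (y - x) < r)%R].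

Lemma sub_enlarge (R : realType) n (A : set 'rV[R]_n) r : (0 < r)%R -> A `<=` enlarge A r.
Proof.
move=> r0 x Ax; exists x => //.
by rewrite subrr enorm0.
Qed.

Lemma open_enlarge (R : realType) n (A : set 'rV[R]_n) r : open A -> open (enlarge A r).
Proof.
rewrite !openE => oA x [y Ay yx].
have : \forall z \near x, A (z + (y - x))%R.
  have c : {for x, continuous (fun z : 'rV[R]_n => z + (y - x))%R}.
    by apply: (@continuousD R _ _ id (cst (y - x)%R) x); [move=> U|exact: cst_continuous].
  have nA : nbhs (x + (y - x))%R A by rewrite addrC subrK; exact: oA.
  exact: (c _ nA).
apply: filterS => z Az; exists (z + (y - x))%R => //.
by rewrite addrAC subrr add0r.
Qed.

Section enlargement.
Context {R : realType} (n : nat).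
Variable w : R.
Hypotheses (w0 : (0 < w)%R) (wE : (w ^+ n.+1)%:E = lebesgue_rV R n.+1 (@eball R n.+1 1)).

(** Brunn-Minkowski for [A] and the ball of radius [r], whose measure is
[(r * w) ^+ n.+1], bounds the [n.+1]-th root of the measure of the enlarged set. The
tangent of [t ^+ n.+1] converts this into an increment of the measure. *)
Lemma lebn_enlarge_diff (M a r : R) (A : set 'rV[R]_n.+1) : (0 <= M)%R -> open A ->
  coord_bounded M A -> (0 < a)%R -> (0 < r)%R -> (a ^+ n.+1)%:E <= lebn R n.+1 A ->
  (n.+1%:R * r * w * a ^+ n)%:E <= lebn R n.+1 (enlarge A r `\` A).
Proof.
move=> M0 oA AM a0 r0 aA.
have mA := open_measurable_rV oA.
have mE := open_measurable_rV (@open_enlarge _ _ _ r oA).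
have Afin : lebesgue_rV R n.+1 A \is a fin_num.
  by rewrite ge0_fin_numE ?measure_ge0// (le_lt_trans (lebesgue_rV_bounded M0 mA AM))// ltry.
have bnd x : lebesgue_rV R n.+1 A = (x ^+ n.+1)%:E -> (0 < x)%R ->
    ((x + r * w) ^+ n.+1)%:E <= lebesgue_rV R n.+1 (enlarge A r).
  move=> xA x0.
  apply: (@brunn_minkowski R n.+1 (Num.max M r) A (@eball R n.+1 r) (enlarge A r)) => //.
  - by rewrite le_max M0.
  - exact: measurable_eball.
  - by move=> v Av i; rewrite le_max AM.
  - by move=> v vr i; rewrite le_max (eball_bounded vr) orbT.
  - by move=> y z Ay zr; exists y => //; rewrite opprD addrA subrr add0r enormN.
  - by rewrite mulr_gt0.
  - by rewrite xA.
  - by rewrite lebesgue_rV_eball_scale// -wE -EFinM exprMn.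
rewrite lebnE; last exact: measurableD.
rewrite lebnE// in aA.
have fA0 : (0 < fine (lebesgue_rV R n.+1 A))%R.
  by rewrite fine_gt0// ltey_eq Afin andbT (lt_le_trans _ aA)// lte_fin exprn_gt0.
have [x x0 xA] := exists_root fA0 (ltn0Sn n).
have xE : lebesgue_rV R n.+1 A = (x ^+ n.+1)%:E by rewrite xA fineK.
rewrite -(@leeD2lE _ (lebesgue_rV R n.+1 A))// -measureU//; last 2 first.
- exact: measurableD.
- by rewrite setIC setDKI.
rewrite setUC setDKU; last exact: sub_enlarge.
apply: (le_trans _ (bnd _ xE x0)); rewrite xE -EFinD lee_fin.
have ax : (a <= x)%R.
  by move: aA; rewrite xE lee_fin ler_pXn2r// nnegrE ltW.
have rw0 : (0 < r * w)%R by rewrite mulr_gt0.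
apply: (le_trans _ (@bernoulli_tangent _ (x + r * w)%R x n _ _)); [|lra|lra].
rewrite lerD2l addrAC subrr add0r.
rewrite (_ : n.+1%:R * r * w * a ^+ n = n.+1%:R * (r * w) * a ^+ n)%R; last by ring.
rewrite mulrAC ler_wpM2r ?(ltW rw0)// ler_wpM2l//.
by rewrite lerXn2r// nnegrE ltW.
Qed.

Notation leb_type := (caratheodory_type ((lebesgue_rV R n.+1)^*)%mu).

Variables (Omega : set 'rV[R]_n.+1) (u : 'rV[R]_n.+1 -> R).
Hypothesis tu : test_function Omega u.

Lemma open_test_superlevel (c : R) : open [set x | c < u x]%R.
Proof.
rewrite (_ : [set x | _] = u @^-1` `]c, +oo[%classic); last first.
  by apply/seteqP; split => x; rewrite /= in_itv /= andbT.
apply: open_comp; last exact: interval_open.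
by move=> x _; exact: (test_continuous tu).
Qed.

Lemma test_superlevel_supp (c : R) : (0 <= c)%R -> [set x | c < u x]%R `<=` supp u.
Proof.
move=> c0 x /= cx; apply: subset_closure; rewrite /= gt_eqF//.
exact: le_lt_trans cx.
Qed.

Lemma lebn_test_superlevel_lty (c : R) : (0 <= c)%R ->
  lebn R n.+1 [set x | c < u x]%R < +oo.
Proof.
move=> c0; have [M M0 uM] := test_supp_bounded tu.
have mA := open_measurable_rV (@open_test_superlevel c).
rewrite lebnE//; apply: (le_lt_trans (lebesgue_rV_bounded M0 mA _)); last exact: ltry.
by move=> v /(test_superlevel_supp c0); exact: uM.
Qed.

Lemma measurable_test_strip (a b : R) : measurable ([set x | a < u x <= b]%R : set leb_type).
Proof.
rewrite (_ : [set x | _] = setT `&` u @^-1` `]a, b]%classic).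
  exact: (continuous_lebn_measurable (test_continuous tu)).
by rewrite setTI; apply/seteqP; split => x; rewrite /= in_itv.
Qed.

Lemma measurable_test_grad (D : set leb_type) :
  measurable_fun D (fun x => (enorm (grad u x))%:E : \bar R).
Proof.
apply/measurable_EFinP; apply: measurable_funTS.
exact: (continuous_lebn_measurable (test_grad_norm_continuous tu)).
Qed.

(** The gap between [r] and [s] ensures that, for small [k], a point at distance
less than [k] from a point with a value above [s] has a value above [r]. *)
Lemma test_level_bound (b r s t : R) : (0 < r)%R -> (r < s)%R -> (s < t)%R ->
  (0 < b)%R -> (b ^+ n.+1)%:E <= lebn R n.+1 [set x | t < u x]%R ->
  (n.+1%:R * w * (t - s) * b ^+ n)%:E <=
  \int[lebn R n.+1]_(x in [set x | r < u x <= t]%R) (enorm (grad u x))%:E.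
Proof.
move=> r0 rs st b0 bt.
have [M M0 uM] := test_supp_bounded tu.
have [L L0 uL] := test_grad_bounded tu.
pose D : set leb_type := [set x | r < u x <= t]%R.
have mD : measurable D by exact: measurable_test_strip.
have Dfin : lebn R n.+1 D < +oo.
  apply: (le_lt_trans _ (lebn_test_superlevel_lty (ltW r0))).
  by apply: le_lebn => x /andP[].
have Dfn : lebn R n.+1 D \is a fin_num by rewrite ge0_fin_numE.
pose G x := enorm (grad u x).
pose mD0 := fine (lebn R n.+1 D).
have mD0_ge0 : (0 <= mD0)%R by exact: fine_ge0.
apply/lee_addgt0Pr => e e0.
(* the total error is 2 * eta times the measure of the strip D, at most e *)
pose eta := (e / (2 * (mD0 + 1)))%R.
have eta0 : (0 < eta)%R by rewrite divr_gt0// mulr_gt0// ltr_wpDl.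
have [d d0 ud] := test_first_order tu eta0.
have Le0 : (0 < L + eta)%R by rewrite ltr_wpDl.
pose k := (Num.min d ((s - r) / (L + eta)))%R.
have k0 : (0 < k)%R by rewrite lt_min d0 divr_gt0// subr_gt0.
have kd : (k <= d)%R by rewrite ge_min lexx.
have kL : (k * (L + eta) <= s - r)%R.
  by rewrite -ler_pdivlMr// ge_min lexx orbT.
(* the step h of the levels contributes an error h <= k * eta per point *)
have [N N0 hk] : exists2 N : nat, (0 < N)%N & ((t - s) / N%:R <= k * eta)%R.
  have ke0 : (0 < k * eta)%R by rewrite mulr_gt0.
  have y0 : (0 <= (t - s) / (k * eta))%R by rewrite divr_ge0 ?subr_ge0// ltW.
  have Ny := archi_boundP y0.
  have N0 : (0 < Num.bound ((t - s) / (k * eta)))%N.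
    by rewrite -(ltr0n R) (le_lt_trans y0).
  exists (Num.bound ((t - s) / (k * eta))) => //.
  by rewrite ler_pdivrMr ?ltr0n// mulrC -ler_pdivrMr// ltW.
pose h := ((t - s) / N%:R)%R.
have h0 : (0 < h)%R by rewrite divr_gt0 ?subr_gt0 ?ltr0n.
(* the levels are s + h, ..., s + N * h = t *)
pose lv (i : nat) := (s + h + i%:R * h)%R.
pose A i : set 'rV[R]_n.+1 := [set x | lv i < u x]%R.
pose E i : set leb_type := enlarge (A i) k `\` A i.
have lv_t (i : 'I_N) : (lv i <= t)%R.
  have Nh : (N%:R * h = t - s)%R by rewrite /h mulrC divfK// pnatr_eq0 -lt0n.
  have : (i.+1%:R * h <= N%:R * h)%R by rewrite ler_pM2r// ler_nat.
  by rewrite Nh -natr1 mulrDl mul1r /lv; lra.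
have lv_s i : (s <= lv i)%R.
  have : (0 <= i%:R * h)%R by rewrite mulr_ge0// ltW.
  by rewrite /lv; lra.
have mE i : measurable (E i).
  have oA : open (A i) by exact: open_test_superlevel.
  by apply: measurableD; apply: lebn_open_measurable => //; exact: open_enlarge.
have lowE (i : 'I_N) : (n.+1%:R * k * w * b ^+ n)%:E <= lebn R n.+1 (E i).
  apply: (lebn_enlarge_diff M0) => //; first exact: open_test_superlevel.
    move=> v vA; apply: uM; apply: test_superlevel_supp vA.
    by rewrite (le_trans _ (lv_s i))// ltW// (lt_trans r0).
  by apply: (le_trans bt); apply: le_lebn => x /=; apply: le_lt_trans.
pose f x := (\sum_(i < N) (h * \1_(E i) x)%R%:E)%E.
have int_f : (N%:R * (h * (n.+1%:R * k * w * b ^+ n)))%:E <= \int[lebn R n.+1]_x f x.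
  rewrite (integral_sum_indic _ _ (ltW h0) mE).
  apply: (@le_trans _ _ (\sum_(i < N) (h * (n.+1%:R * k * w * b ^+ n))%:E)).
    by rewrite sumEFin sumr_const card_ord lee_fin [leLHS]mulr_natl lexx.
  apply: lee_sum => i _; rewrite EFinM.
  by apply: lee_wpmul2l; [rewrite lee_fin ltW|exact: lowE].
have Emem x i : (i < N)%N -> E i x -> [/\ (u x <= lv i)%R,
    (lv i < u x + k * (G x + eta))%R & D x].
  move=> iN [[y Ay yx] /negP]; rewrite -leNgt => ux.
  have G0 : (0 <= G x)%R by exact: enorm_ge0.
  have kG : (lv i < u x + k * (G x + eta))%R.
    have := ud x y (lt_le_trans yx kd).
    have : (enorm (y - x) * (G x + eta) <= k * (G x + eta))%R.
      by rewrite ler_wpM2r ?addr_ge0 ?(ltW eta0)// ltW.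
    by move: Ay; rewrite /A /= -/(G x); lra.
  split => //; apply/andP; split; last exact: le_trans (lv_t (Ordinal iN)).
  have : (k * (G x + eta) <= k * (L + eta))%R.
    by rewrite ler_wpM2l ?(ltW k0)// lerD2r uL.
  by have := lv_s i; lra.
have f_le x : f x <= ((fun x => (k * (G x + 2 * eta))%:E) \_ D) x.
  rewrite patchE /f sumEFin; have [/set_mem Dx|/negP nDx] := boolP (x \in D).
    apply: (@le_trans _ _ (k * (G x + eta) + h)%:E); last first.
      by rewrite lee_fin; move: hk; rewrite -/h; lra.
    have G0 : (0 <= G x)%R by exact: enorm_ge0.
    have uq : (u x <= u x + k * (G x + eta))%R.
      by rewrite lerDl mulr_ge0 ?addr_ge0 ?(ltW k0)// ltW.
    have := level_count (s + h)%R N h0 uq.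
    rewrite [(u x + _ - u x)%R]addrAC subrr add0r lee_fin; apply: le_trans.
    apply: ler_sum => i _; rewrite ler_wpM2l ?(ltW h0)// indicE.
    have [/set_mem Eix|_] := boolP (x \in E i); last by rewrite ler_nat.
    by have [h1 h2 _] := Emem _ _ (ltn_ord i) Eix; rewrite -/(lv i) h1 h2.
  rewrite big1 => [|i _]; first exact: lexx.
  rewrite indicE; have [/set_mem Eix|_] := boolP (x \in E i); last by rewrite mulr0.
  by have [_ _ Dx] := Emem _ _ (ltn_ord i) Eix; case: nDx; rewrite inE.
have mG : measurable_fun D (G : leb_type -> R).
  by apply/measurable_EFinP; exact: measurable_test_grad.
have eta20 : (0 <= 2 * eta)%R by rewrite mulr_ge0// ltW.
have int_g := integral_affine_comp (lebn R n.+1) mD (ltW k0) eta20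
  (fun x => enorm_ge0 (grad u x)) mG.
have step : (N%:R * (h * (n.+1%:R * k * w * b ^+ n)))%:E <=
    k%:E * (\int[lebn R n.+1]_(x in D) (G x)%:E + (2 * eta)%:E * lebn R n.+1 D).
  rewrite -int_g; apply: (le_trans int_f); rewrite [leRHS]integral_mkcond.
  apply: ge0_le_integral.
  - exact: measurableT.
  - move=> x _; rewrite /f sumEFin lee_fin sumr_ge0// => i _.
    by rewrite mulr_ge0// ltW.
  - apply: emeasurable_sum => i; apply/measurable_EFinP; apply: measurable_funM.
      exact: measurable_cst.
    exact: measurable_indic.
  - apply/(measurable_restrictT _ _).1; first exact: mD.
    apply/measurable_EFinP; apply: measurable_funM; first exact: measurable_cst.
    by apply: measurable_funD => //; exact: measurable_cst.
  - by move=> x _; exact: f_le.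
have Nh : (N%:R * h = t - s)%R by rewrite /h mulrC divfK// pnatr_eq0 -lt0n.
rewrite mulrA Nh (_ : (t - s) * _ = k * (n.+1%:R * w * (t - s) * b ^+ n))%R in step; last by ring.
rewrite EFinM lee_pmul2l// in step.
apply: (le_trans step); rewrite leeD2l//.
rewrite -(fineK Dfn) -EFinM lee_fin -/mD0 /eta.
rewrite (_ : 2 * _ * _ = e * (mD0 / (mD0 + 1)))%R; last first.
  by field; rewrite gt_eqF// ltr_wpDl.
by rewrite ler_piMr ?(ltW e0)// ler_pdivrMr ?ltr_wpDl// mul1r lerDl.
Qed.

End enlargement.

(** * Integrals over a general measure space *)

Section measure_generalities.
Context d (T : measurableType d) (R : realType) (mu : {measure set T -> \bar R}).

(** The integral of a nonnegative function is a supremum over the simple functions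
below it, so monotonicity holds without measurability. The larger function will be
the weighted gradient, whose denominator involves the distribution function of
[phi]. *)
Lemma ge0_le_integral_lower (D : set T) (f1 f2 : T -> \bar R) :
  (forall x, D x -> 0 <= f1 x) -> (forall x, D x -> f1 x <= f2 x) ->
  \int[mu]_(x in D) f1 x <= \int[mu]_(x in D) f2 x.
Proof.
move=> f10 f12; rewrite [leLHS]integral_mkcond [leRHS]integral_mkcond.
have h1 x : 0 <= (f1 \_ D) x by exact: erestrict_ge0.
have h12 x : (f1 \_ D) x <= (f2 \_ D) x by exact: lee_restrict.
have h2 x : 0 <= (f2 \_ D) x by exact: le_trans (h12 x).
rewrite !ge0_integralTE//; apply: le_ereal_sup => _ [s /= sf <-].
by exists s => //= x; exact: le_trans (h12 x).
Qed.

Lemma markov_on (D : set T) (f : T -> R) (e : R) : measurable D ->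
  measurable_fun D f -> (0 < e)%R ->
  e%:E * mu (D `&` [set x | e <= `|f x|]%R) <= \int[mu]_(x in D) (`|f x|)%R%:E.
Proof.
move=> mD mf e0.
have mA : measurable (D `&` [set x | (e <= `|f x|)%R]).
  rewrite (_ : [set x | _] = [set x | e%:E <= (`|f x|)%R%:E]); last first.
    by apply/seteqP; split => x; rewrite /= lee_fin.
  by apply: emeasurable_fun_c_infty => //; apply/measurable_EFinP; exact: measurableT_comp.
rewrite -integral_cst//; apply: (@le_trans _ _
  (\int[mu]_(x in D `&` [set x | e <= `|f x|]%R) (`|f x|)%R%:E)).
  by apply: ge0_le_integral_lower => x [Dx ex]; rewrite lee_fin// ltW.
apply: ge0_subset_integral => //.
by apply/measurable_EFinP; exact: measurableT_comp.
Qed.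

Lemma integral_small_set (D : set T) (f : T -> R) : measurable D ->
  (forall x, 0 <= f x)%R -> mu.-integrable D (EFin \o f) ->
  forall e : R, (0 < e)%R -> exists2 r : R, (0 < r)%R &
    forall A, measurable A -> A `<=` D -> mu A < r%:E ->
      \int[mu]_(x in A) (f x)%:E <= e%:E.
Proof.
move=> mD f0 intf e e0.
have intf' : mu.-integrable setT (EFin \o (f \_ D)%R).
  by rewrite -restrict_EFin; exact: (integrable_mkcond (EFin \o f) mD).1.
have [r [r0 rP]] := integral_normr_continuous intf' e0.
exists r => // A mA AD Ar.
have -> : \int[mu]_(x in A) (f x)%:E = \int[mu]_(x in A) `|((f \_ D)%R x)%:E|.
  apply: eq_integral => x /set_mem Ax; rewrite patchE mem_set; last exact: AD.
  by rewrite /= ger0_norm.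
have fin : \int[mu]_(x in A) `|((f \_ D)%R x)%:E| \is a fin_num.
  have : mu.-integrable A (EFin \o (f \_ D)%R) by exact: integrableS intf'.
  by move=> /integrableP[_]; rewrite ge0_fin_numE// integral_ge0.
by rewrite -(fineK fin) lee_fin ltW//; exact: rP.
Qed.

Lemma ge0_integral_setU_le (A B : set T) (f : T -> \bar R) : measurable A ->
  measurable B -> measurable_fun (A `|` B) f -> (forall x, 0 <= f x) ->
  \int[mu]_(x in A `|` B) f x <= \int[mu]_(x in A) f x + \int[mu]_(x in B) f x.
Proof.
move=> mA mB mf f0; have mBA : measurable (B `\` A) by exact: measurableD.
have ABE : A `|` B = A `|` (B `\` A).
  apply/seteqP; split => x [Ax|]; [by left| |by left|by case; right].
  by have [|] := pselect (A x); [left|right].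
rewrite ABE in mf *; rewrite ge0_integral_setU//; last first.
  by apply/disj_setPS => x [? []].
apply: leeD => //; apply: ge0_subset_integral; [exact: mBA|exact: mB| | |exact: subDsetl].
- by apply: measurable_funS mf; [exact: measurableU|rewrite -ABE; exact: subsetUr].
- by move=> x _; exact: f0.
Qed.

End measure_generalities.

Section euclidean_norm_measurable.
Context d (T : measurableType d) (R : realType) (mu : {measure set T -> \bar R}) (n : nat).
Variables (D : set T) (v : T -> 'rV[R]_n).

(** Each square [x_i ^+ 2] is at most [|x_i|] times the norm of [x]. *)
Lemma enorm_le_sum (x : 'rV[R]_n) : (enorm x <= \sum_(i < n) `|x ord0 i|)%R.
Proof.
have [->|x0] := eqVneq (enorm x) 0%R; first by rewrite sumr_ge0.
have xgt0 : (0 < enorm x)%R by rewrite lt_def x0 enorm_ge0.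
rewrite -(ler_pM2r xgt0) -expr2 sqr_enorm mulr_suml; apply: ler_sum => i _.
rewrite -real_normK ?num_real// expr2.
by rewrite ler_wpM2l// coord_le_enorm.
Qed.

Lemma measurable_fun_enorm : (forall i, measurable_fun D (fun x => v x ord0 i)) ->
  measurable_fun D (fun x => enorm (v x)).
Proof.
move=> mv; rewrite (_ : (fun x => _) =
  Num.sqrt \o (fun x => \sum_(i < n) v x ord0 i ^+ 2)%R); last exact/funext.
apply: measurableT_comp.
  by apply: continuous_measurable_fun; exact: sqrt_continuous.
by apply: measurable_sum => i; exact: measurable_funX.
Qed.

Lemma integrable_enorm : measurable D ->
  (forall i, mu.-integrable D (fun x => (v x ord0 i)%:E)) ->
  mu.-integrable D (fun x => (enorm (v x))%:E).
Proof.
move=> mD iv.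
have isum : mu.-integrable D (fun x => \sum_(i < n) (`|v x ord0 i|)%R%:E).
  by apply: integrable_sum => // i _; exact: (integrable_abse (iv i)).
apply: (le_integrable mD _ _ isum).
  apply/measurable_EFinP; apply: measurable_fun_enorm => i.
  by apply/measurable_EFinP; have /integrableP[] := iv i.
move=> x _; rewrite sumEFin /= lee_fin !ger0_norm ?enorm_ge0//; first exact: enorm_le_sum.
by rewrite sumr_ge0.
Qed.

End euclidean_norm_measurable.

(** * Comparison of a Sobolev function with a test function *)

Section sobolev_level.
Context {R : realType} (n : nat).
Notation leb_type := (caratheodory_type ((lebesgue_rV R n.+1)^*)%mu).
Local Notation mu := (lebn R n.+1).

Variables (Omega : set 'rV[R]_n.+1) (phi : 'rV[R]_n.+1 -> R) (g : 'rV[R]_n.+1 -> 'rV[R]_n.+1).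
Hypotheses (oOmega : open Omega) (iphi : integrable_on Omega phi)
  (ig : forall i, integrable_on Omega (fun x => g x ord0 i)).

Lemma measurable_Omega : measurable (Omega : set leb_type).
Proof. exact: lebn_open_measurable. Qed.

Lemma measurable_phi : measurable_fun (Omega : set leb_type) (phi : leb_type -> R).
Proof. by apply/measurable_EFinP; have /integrableP[] := iphi. Qed.

Lemma measurable_enorm_g : measurable_fun (Omega : set leb_type) (fun x : leb_type => enorm (g x)).
Proof.
apply: measurable_fun_enorm => i.
by apply/measurable_EFinP; have /integrableP[] := ig i.
Qed.

Definition superlevel (t : R) : set 'rV[R]_n.+1 := [set z | Omega z /\ (t <= phi z)%R].

Definition strip (s t : R) : set 'rV[R]_n.+1 := [set z | Omega z /\ (s < phi z <= t)%R].

Lemma measurable_superlevel t : measurable (superlevel t : set leb_type).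
Proof.
rewrite (_ : superlevel t = Omega `&` [set x | t%:E <= (phi x)%:E]).
  apply: emeasurable_fun_c_infty; first exact: measurable_Omega.
  by apply/measurable_EFinP; exact: measurable_phi.
by apply/seteqP; split => x; rewrite /superlevel /= lee_fin.
Qed.

Lemma measurable_strip s t : measurable (strip s t : set leb_type).
Proof.
have h : measurable (Omega `&` phi @^-1` `]s, t]%classic : set leb_type).
  by apply: measurable_phi; [exact: measurable_Omega|exact: measurable_itv].
by rewrite (_ : strip s t = (Omega `&` phi @^-1` `]s, t]%classic)).
Qed.

Section approximation.
Variable psi : 'rV[R]_n.+1 -> R.
Hypothesis tpsi : test_function Omega psi.

Lemma measurable_diff_phi :
  measurable_fun (Omega : set leb_type) ((phi \- psi)%R : leb_type -> R).
Proof.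
apply: measurable_funB; first exact: measurable_phi.
by apply: measurable_funTS; exact: (continuous_lebn_measurable (test_continuous tpsi)).
Qed.

Lemma measurable_diff_grad :
  measurable_fun (Omega : set leb_type) (fun x : leb_type => enorm (g x - grad psi x)%R).
Proof.
apply: measurable_fun_enorm => i.
rewrite (_ : (fun _ => _) = (fun x => g x ord0 i) \- partial i psi)%R; last first.
  by apply/funext => x; rewrite !mxE.
apply: measurable_funB; first by apply/measurable_EFinP; have /integrableP[] := ig i.
apply: measurable_funTS.
exact: (continuous_lebn_measurable (test_partial_continuous tpsi (i := i))).
Qed.

(** Away from this set a level of [psi] determines a level of [phi] up to [e]. *)
Definition bad_set (e : R) : set 'rV[R]_n.+1 :=
  Omega `&` [set x | (e <= `|(phi \- psi) x|)%R].

Lemma measurable_bad_set e : measurable (bad_set e : set leb_type).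
Proof.
rewrite /bad_set (_ : [set x | (e <= `|(phi \- psi) x|)%R] =
    [set x | e%:E <= (`|(phi \- psi) x|)%R%:E]); last first.
  by apply/seteqP; split => x; rewrite /= lee_fin.
apply: emeasurable_fun_c_infty; first exact: measurable_Omega.
apply/measurable_EFinP; apply: measurableT_comp; first exact: normr_measurable.
exact: measurable_diff_phi.
Qed.

Lemma superlevel_split (e t : R) : superlevel t `<=` [set x | t - e < psi x]%R `|` bad_set e.
Proof.
move=> x [Ox tx]; have [h|h] := ltP (t - e)%R (psi x); first by left.
by right; split => //=; apply: (le_trans _ (ler_norm _)); lra.
Qed.

Lemma strip_split (e s t : R) :
  [set x | s + e < psi x <= t - e]%R `&` Omega `<=` strip s t `|` bad_set e.
Proof.
move=> x [/= /andP[h1 h2] Ox].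
have [h|h] := leP e (`|(phi \- psi) x|)%R; first by right.
by left; split => //; move: h; rewrite ltr_norml /= => /andP[h3 h4]; apply/andP; split; lra.
Qed.

Lemma strip_Omega (a b : R) : (0 <= a)%R -> [set x | a < psi x <= b]%R `<=` Omega.
Proof.
move=> a0 x /andP[ax _]; case: tpsi => _ _; apply.
exact: (test_superlevel_supp a0).
Qed.

(** The gradient of [psi] is compared with [g] on the strip of [psi], and this strip
lies in the strip of [phi] up to the bad set. *)
Lemma grad_psi_strip (e s t : R) : (0 <= s)%R -> (0 < e)%R ->
  \int[mu]_(x in [set x | s + e < psi x <= t - e]%R) (enorm (grad psi x))%:E <=
  \int[mu]_(x in Omega) (enorm (g x - grad psi x)%R)%:E +
  (\int[mu]_(x in strip s t) (enorm (g x))%:E + \int[mu]_(x in bad_set e) (enorm (g x))%:E).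
Proof.
move=> s0 e0; set P := [set x | _].
have PO : P `<=` Omega by apply: strip_Omega; lra.
have mP : measurable (P : set leb_type) := measurable_test_strip tpsi _ _.
have mO := measurable_Omega.
have mg := measurable_enorm_g.
have mdg := measurable_diff_grad.
apply: (@le_trans _ _ (\int[mu]_(x in P) ((enorm (g x - grad psi x)%R)%:E + (enorm (g x))%:E))).
  apply: ge0_le_integral_lower => x _; first by rewrite lee_fin enorm_ge0.
  rewrite -EFinD lee_fin.
  have := enormD (g x - grad psi x)%R (- g x)%R.
  by rewrite addrAC subrr add0r !enormN.
rewrite ge0_integralD; last 5 first.
- exact: mP.
- by move=> x _; rewrite lee_fin enorm_ge0.
- by apply/measurable_EFinP; exact: measurable_funS mdg.
- by move=> x _; rewrite lee_fin enorm_ge0.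
- by apply/measurable_EFinP; exact: measurable_funS mg.
apply: leeD.
  apply: ge0_subset_integral; [exact: mP|exact: mO| | |exact: PO].
  - exact/measurable_EFinP.
  - by move=> x _; rewrite lee_fin enorm_ge0.
have mS := measurable_strip s t; have mB := measurable_bad_set e.
have SBO : strip s t `|` bad_set e `<=` Omega by move=> x [[]|[]].
apply: (@le_trans _ _ (\int[mu]_(x in strip s t `|` bad_set e) (enorm (g x))%:E)).
  apply: ge0_subset_integral; [exact: mP|exact: measurableU| | |].
  - by apply/measurable_EFinP; exact: measurable_funS mg.
  - by move=> x _; rewrite lee_fin enorm_ge0.
  - by move=> x Px; apply: strip_split; split => //; exact: PO.
apply: ge0_integral_setU_le; [exact: mS|exact: mB| |].
- by apply/measurable_EFinP; exact: measurable_funS mg.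
- by move=> x; rewrite lee_fin enorm_ge0.
Qed.
End approximation.
End sobolev_level.

(** * Level bound for Sobolev functions *)

Section sobolev_level_bound.
Context {R : realType} (n : nat).
Notation leb_type := (caratheodory_type ((lebesgue_rV R n.+1)^*)%mu).
Local Notation mu := (lebn R n.+1).

Variables (w : R) (Omega : set 'rV[R]_n.+1) (phi : 'rV[R]_n.+1 -> R)
  (g : 'rV[R]_n.+1 -> 'rV[R]_n.+1).
Hypotheses (w0 : (0 < w)%R) (wE : (w ^+ n.+1)%:E = lebesgue_rV R n.+1 (@eball R n.+1 1))
  (oOmega : open Omega) (iphi : integrable_on Omega phi)
  (ig : forall i, integrable_on Omega (fun x => g x ord0 i))
  (approx : forall e : R, (0 < e)%R -> exists2 psi, test_function Omega psi &
     sobolev11_norm Omega (phi \- psi)%R (g \- grad psi)%R < e%:E).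

Lemma lebn_bad_set psi (e k : R) : test_function Omega psi -> (0 < k)%R ->
  sobolev11_norm Omega (phi \- psi)%R (g \- grad psi)%R < e%:E ->
  mu (bad_set Omega phi psi k) < (e / k)%:E.
Proof.
move=> tpsi k0 ne.
have mO := measurable_Omega oOmega.
have h : k%:E * mu (bad_set Omega phi psi k) < e%:E.
  apply: le_lt_trans ne.
  apply: (le_trans (markov_on (lebn R n.+1) mO (measurable_diff_phi iphi tpsi) k0)).
  by rewrite /sobolev11_norm leeDl// integral_ge0// => x _; rewrite lee_fin enorm_ge0.
by rewrite -(@lte_pmul2l _ k%:E)// -EFinM mulrC divfK ?gt_eqF.
Qed.

(** The test function is chosen so close to [phi] that the bad set has measure at most
[b ^+ n.+1 - b' ^+ n.+1] and carries little of the integral of the norm of [g]. The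
slack [k] in the levels absorbs the shifts. *)
Lemma sobolev_level_bound_slack (b b' k s t : R) : (0 < s)%R -> (0 < k)%R ->
  (s + 3 * k < t)%R -> (0 < b')%R -> (b' < b)%R ->
  (b ^+ n.+1)%:E <= mu (superlevel Omega phi t) ->
  (n.+1%:R * w * (t - s - 3 * k) * b' ^+ n)%:E <=
  \int[mu]_(x in strip Omega phi s t) (enorm (g x))%:E.
Proof.
move=> s0 k0 st b'0 b'b bS; apply/lee_addgt0Pr => e e0.
have sk0 : (0 < s + k)%R by rewrite addr_gt0.
have sk2 : (s + k < s + 2 * k)%R by lra.
have skt : (s + 2 * k < t - k)%R by lra.
have e20 : (0 < e / 2)%R by rewrite divr_gt0.
have mO := measurable_Omega oOmega.
have [r r0 rP] := integral_small_set mO (fun x => enorm_ge0 (g x))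
  (integrable_enorm mO ig) e20.
pose c := (b ^+ n.+1 - b' ^+ n.+1)%R.
have c0 : (0 < c)%R by rewrite subr_gt0 ltr_pXn2r// nnegrE ltW// (lt_trans b'0).
pose e1 := (Num.min (e / 2) (k * Num.min r c))%R.
have e10 : (0 < e1)%R by rewrite lt_min e20 mulr_gt0// lt_min r0.
have [psi tpsi ne] := approx e10.
have mB := measurable_bad_set oOmega iphi tpsi k.
have Bsmall : mu (bad_set Omega phi psi k) < (Num.min r c)%:E.
  apply: (lt_le_trans (lebn_bad_set tpsi k0 ne)); rewrite lee_fin.
  by rewrite ler_pdivrMr// mulrC ge_min lexx orbT.
have Bfin : mu (bad_set Omega phi psi k) \is a fin_num.
  by rewrite ge0_fin_numE ?measure_ge0// (lt_trans Bsmall)// ltry.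
have psi_big : (b' ^+ n.+1)%:E <= mu [set x | t - k < psi x]%R.
  rewrite (_ : b' ^+ n.+1 = b ^+ n.+1 - c)%R; last by rewrite /c; ring.
  rewrite EFinB leeBlDr//.
  have : mu (superlevel Omega phi t) <= mu [set x | t - k < psi x]%R +
      mu (bad_set Omega phi psi k).
    apply: (le_trans (le_lebn (@superlevel_split _ _ _ _ _ k t))).
    exact: outer_measureU2.
  move=> /(le_trans bS) /le_trans; apply; rewrite leeD2l//.
  by apply: (le_trans (ltW Bsmall)); rewrite lee_fin ge_min lexx orbT.
have := test_level_bound w0 wE tpsi sk0 sk2 skt b'0 psi_big.
rewrite (_ : t - k - (s + 2 * k) = t - s - 3 * k)%R; last by ring.
move=> h; apply: (le_trans h).
apply: (le_trans (grad_psi_strip oOmega iphi ig tpsi t (ltW s0) k0)).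
rewrite addeC -addeA leeD2l// [e]splitr EFinD leeD//.
  apply: rP => //; first by move=> x [].
  by apply: (lt_le_trans Bsmall); rewrite lee_fin ge_min lexx.
apply: (@le_trans _ _ e1%:E); last by rewrite lee_fin ge_min lexx.
apply: le_trans (ltW ne); rewrite /sobolev11_norm leeDr//.
by apply: integral_ge0 => x _; rewrite lee_fin.
Qed.

(** The slack in the levels and the loss [b - b'] tend to zero together. *)
Lemma sobolev_level_bound (b s t : R) : (0 < s)%R -> (s < t)%R -> (0 < b)%R ->
  (b ^+ n.+1)%:E <= mu (superlevel Omega phi t) ->
  (n.+1%:R * w * (t - s) * b ^+ n)%:E <=
  \int[mu]_(x in strip Omega phi s t) (enorm (g x))%:E.
Proof.
move=> s0 st b0 bS.
set I := \int[_]_(x in _) _.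
have I0 : 0 <= I by apply: integral_ge0 => x _; rewrite lee_fin enorm_ge0.
have [->|Ify] := eqVneq I +oo; first by rewrite leey.
have Ifin : I \is a fin_num by rewrite ge0_fin_numE// ltey.
rewrite -(fineK Ifin) lee_fin; set J := fine I.
(* both the slack k and the loss b - b' are proportional to th *)
have step (th : R) : (0 < th < 1)%R ->
    (n.+1%:R * w * (t - s) * b ^+ n * (1 - th) ^+ n.+1 <= J)%R.
  move=> /andP[th0 th1].
  have k0 : (0 < (t - s) * th / 3)%R by rewrite divr_gt0// mulr_gt0// subr_gt0.
  have ts : (0 < t - s)%R by lra.
  have kst : (s + 3 * ((t - s) * th / 3) < t)%R.
    have : ((t - s) * th < t - s)%R by rewrite gtr_pMr.
    by lra.
  have b'0 : (0 < b * (1 - th))%R by rewrite mulr_gt0//; lra.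
  have b'b : (b * (1 - th) < b)%R by rewrite gtr_pMr//; lra.
  have := sobolev_level_bound_slack s0 k0 kst b'0 b'b bS.
  rewrite -/I -(fineK Ifin) lee_fin; apply: le_trans.
  rewrite le_eqVlt; apply/orP; left; apply/eqP.
  by rewrite exprMn exprS; field.
set X := (n.+1%:R * w * (t - s) * b ^+ n)%R in step *.
have X0 : (0 <= X)%R by rewrite !mulr_ge0 ?exprn_ge0 ?(ltW w0) ?(ltW b0) ?subr_ge0 ?(ltW st).
apply/ler_addgt0Pr => e e0.
pose th := (Num.min (1 / 2) (e / (n.+1%:R * (X + 1))))%R.
have X1 : (0 < n.+1%:R * (X + 1))%R by rewrite mulr_gt0// ltr_wpDl.
have th0 : (0 < th)%R by rewrite lt_min divr_gt0// divr_gt0.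
have th2 : (th <= 1 / 2)%R by rewrite ge_min lexx.
have the : (th * (n.+1%:R * (X + 1)) <= e)%R.
  by rewrite -ler_pdivlMr// ge_min lexx orbT.
have th01 : (0 < th < 1)%R by rewrite th0; lra.
have hJ := step _ th01.
have bern : (1 - n.+1%:R * th <= (1 - th) ^+ n.+1)%R.
  have := @bernoulli_tangent _ (1 - th)%R 1%R n; rewrite !expr1n mulr1.
  rewrite (_ : 1 + n.+1%:R * (1 - th - 1) = 1 - n.+1%:R * th)%R; last by ring.
  by apply; lra.
have hX : (X * (1 - n.+1%:R * th) <= X * (1 - th) ^+ n.+1)%R by rewrite ler_wpM2l.
apply: (le_trans _ (lerD (le_trans hX hJ) the)).
rewrite (_ : X * _ + th * _ = X + n.+1%:R * th)%R; last by ring.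
by rewrite lerDl mulr_ge0// ltW.
Qed.

End sobolev_level_bound.

(** * Riemann sums over levels *)

(** A ratio [q <= 1] satisfies [q ^+ n.+1 <= q ^+ n], and
[1 - b_(i+1) ^+ n.+1 / b_i ^+ n.+1 <= (b_i ^+ n.+1 - b_(i+1) ^+ n.+1) / c], whose sum
telescopes. *)
Lemma sum_ratio_ge (R : realFieldType) n (b : nat -> R) (c : R) N :
  (forall i, (i <= N)%N -> 0 < b i)%R -> (forall i, (i < N)%N -> b i.+1 <= b i)%R ->
  (0 < c)%R -> (forall i, (i <= N)%N -> c <= b i ^+ n.+1)%R ->
  (N%:R - (b 0%N ^+ n.+1 - b N ^+ n.+1) / c <= \sum_(i < N) (b i.+1 / b i) ^+ n)%R.
Proof.
move=> b0 bd c0 cb; elim: N b0 bd cb => [|N IHN] b0 bd cb.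
  by rewrite big_ord0 subrr mul0r subr0.
rewrite big_ord_recr /=.
have IH := IHN (fun i iN => b0 i (leqW iN)) (fun i iN => bd i (leqW iN))
  (fun i iN => cb i (leqW iN)).
apply: (le_trans _ (lerD IH (lexx _))).
have bN : (0 < b N)%R by exact: b0.
have bN1 : (0 < b N.+1)%R by exact: b0.
have q1 : (b N.+1 / b N <= 1)%R by rewrite ler_pdivrMr// mul1r bd.
have q0 : (0 <= b N.+1 / b N)%R by rewrite divr_ge0// ltW.
have qn : ((b N.+1 / b N) ^+ n.+1 <= (b N.+1 / b N) ^+ n)%R.
  by rewrite exprS ler_piMl// exprn_ge0.
apply: (le_trans _ (lerD (lexx _) qn)).
rewrite expr_div_n -natr1.
set x := (b N ^+ n.+1)%R; set y := (b N.+1 ^+ n.+1)%R; set z := (b 0%N ^+ n.+1)%R.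
have x0 : (0 < x)%R by rewrite exprn_gt0.
have cx : (c <= x)%R by exact: cb.
have yx : (y <= x)%R by rewrite lerXn2r ?nnegrE ?(ltW bN) ?(ltW bN1)// bd.
rewrite -subr_ge0.
rewrite (_ : _ - _ = (x - y) * (c^-1 - x^-1))%R; last first.
  by field; rewrite !gt_eqF.
by rewrite mulr_ge0 ?subr_ge0// lef_pV2 ?posrE.
Qed.

Lemma integral_sum_scaled_indic d (T : measurableType d) (R : realType)
    (mu : {measure set T -> \bar R}) (D : set T) N (c : nat -> R) (A : nat -> set T)
    (G : T -> R) : measurable D -> (forall i, 0 <= c i)%R ->
  (forall i, measurable (A i)) -> (forall i, A i `<=` D) ->
  (forall x, 0 <= G x)%R -> measurable_fun D G ->
  \int[mu]_(x in D) (\sum_(i < N) (c i * (G x * \1_(A i) x))%R%:E) =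
  \sum_(i < N) (c i)%:E * \int[mu]_(x in A i) (G x)%:E.
Proof.
move=> mD c0 mA AD G0 mG.
have mGA i : measurable_fun D (fun x => G x * \1_(A i) x)%R.
  by apply: measurable_funM => //; exact: measurable_indic.
rewrite ge0_integral_sum; last 3 first.
- exact: mD.
- by move=> i; apply/measurable_EFinP; exact: measurable_funM.
- by move=> i x _; rewrite lee_fin !mulr_ge0.
apply: eq_bigr => i _; under eq_integral do rewrite EFinM.
rewrite ge0_integralZl; last 4 first.
- exact: mD.
- exact/measurable_EFinP.
- by move=> x _; rewrite lee_fin mulr_ge0.
- by rewrite lee_fin.
congr (_ * _).
rewrite -[in RHS](setIidr (AD i)) integral_mkcondr.
apply: eq_integral => x _; rewrite patchE indicE.
by case: ifP => _; rewrite ?mulr1 ?mulr0.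
Qed.

Section rearrangement.
Context {R : realType} (n : nat).
Notation leb_type := (caratheodory_type ((lebesgue_rV R n.+1)^*)%mu).
Local Notation mu := (lebn R n.+1).

Variables (w : R) (Omega : set 'rV[R]_n.+1) (phi : 'rV[R]_n.+1 -> R)
  (g : 'rV[R]_n.+1 -> 'rV[R]_n.+1).
Hypotheses (w0 : (0 < w)%R) (wE : (w ^+ n.+1)%:E = lebesgue_rV R n.+1 (@eball R n.+1 1))
  (oOmega : open Omega) (iphi : integrable_on Omega phi)
  (ig : forall i, integrable_on Omega (fun x => g x ord0 i))
  (approx : forall e : R, (0 < e)%R -> exists2 psi, test_function Omega psi &
     sobolev11_norm Omega (phi \- psi)%R (g \- grad psi)%R < e%:E).

Definition weighted_grad (x : 'rV[R]_n.+1) : \bar R :=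
  (enorm (g x))%:E / (mu [set z | Omega z /\ (phi x <= phi z)%R]) `^ (n%:R / n.+1%:R).

Lemma weighted_grad_ge0 x : 0 <= weighted_grad x.
Proof.
by rewrite /weighted_grad mule_ge0 ?lee_fin ?enorm_ge0// inve_ge0 poweR_ge0.
Qed.

(** Above level [t] the superlevel set through [x] is contained in that of level
[t]. *)
Lemma weighted_grad_lower (b t : R) x : (0 < b)%R ->
  mu (superlevel Omega phi t) = (b ^+ n.+1)%:E -> (t < phi x)%R ->
  ((b ^+ n)^-1 * enorm (g x))%:E <= weighted_grad x.
Proof.
move=> b0 bE tx; rewrite /weighted_grad.
set y := lebn _ _ _.
have yb : y <= (b ^+ n.+1)%:E.
  by rewrite -bE; apply: le_lebn => z [Oz xz]; split => //; rewrite (le_trans _ xz)// ltW.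
have y0 : 0 <= y by exact: outer_measure_ge0.
have yfin : y \is a fin_num by rewrite ge0_fin_numE// (le_lt_trans yb)// ltry.
move: yb y0; rewrite -(fineK yfin) !lee_fin; set r := fine y => rb r0.
rewrite poweR_EFin.
have rbn : (r `^ (n%:R / n.+1%:R) <= b ^+ n)%R.
  have -> : (b ^+ n = (b ^+ n.+1) `^ (n%:R / n.+1%:R))%R.
    by rewrite -(@powR_mulrn _ b n.+1) ?(ltW b0)// -powRrM mulrC divfK ?pnatr_eq0// powR_mulrn// ltW.
  by rewrite ge0_ler_powR// ?divr_ge0// nnegrE// exprn_ge0// ltW.
have r0' : (0 <= r `^ (n%:R / n.+1%:R))%R by exact: powR_ge0.
rewrite inver; case: eqP => [_|/eqP rn0].
  have := enorm_ge0 (g x); rewrite le_eqVlt => /predU1P[<-|gx].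
    by rewrite mulr0 mul0e.
  by rewrite gt0_muley ?leey// lte_fin.
rewrite -EFinM lee_fin mulrC ler_wpM2l ?enorm_ge0//.
by rewrite lef_pV2// ?posrE ?exprn_gt0// lt_def rn0.
Qed.

Lemma superlevel_fin_num t : (0 < t)%R -> mu (superlevel Omega phi t) \is a fin_num.
Proof.
move=> t0; have mO := measurable_Omega oOmega; have mphi := measurable_phi iphi.
have := markov_on (lebn R n.+1) mO mphi t0.
have /integrableP[_ /= fin] := iphi.
move=> /le_lt_trans/(_ fin); set B := Omega `&` _ => tB.
have Boo : mu B < +oo.
  by rewrite ltey; apply/eqP => BE; move: tB; rewrite BE gt0_muley ?lte_fin// ltxx.
rewrite ge0_fin_numE ?measure_ge0//; apply: (le_lt_trans _ Boo).
by apply: le_lebn => z [Oz tz]; split => //=; rewrite (le_trans tz)// ler_norm.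
Qed.


(** The strips between consecutive levels are disjoint, so the integrand dominates the
sum of their lower bounds. The level bound estimates the contribution of each
strip. *)
Lemma partition_bound (t0 T : R) N : (0 < t0)%R -> (t0 < T)%R -> (0 < N)%N ->
  0 < mu (superlevel Omega phi T) ->
  (n.+1%:R * w * (T - t0) *
    (1 - fine (mu (superlevel Omega phi t0)) / fine (mu (superlevel Omega phi T)) / N%:R))%:E
  <= \int[mu]_(x in Omega) weighted_grad x.
Proof.
move=> t00 t0T N0 ST.
have N0' : (0 < N%:R :> R)%R by rewrite ltr0n.
pose h := ((T - t0) / N%:R)%R.
have h0 : (0 < h)%R by rewrite divr_gt0// subr_gt0.
pose t (i : nat) := (t0 + i%:R * h)%R.
have tpos i : (0 < t i)%R by rewrite ltr_wpDr// mulr_ge0// ltW.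
have tS i : (t i.+1 = t i + h)%R by rewrite /t -natr1 mulrDl mul1r addrA.
have tmono i j : (i <= j)%N -> (t i <= t j)%R.
  by move=> ij; rewrite /t lerD2l ler_wpM2r ?(ltW h0)// ler_nat.
have t_0 : t 0%N = t0 by rewrite /t mul0r addr0.
have t_N : t N = T.
  by rewrite /t /h mulrC divfK ?gt_eqF// addrC subrK.
pose m i := fine (mu (superlevel Omega phi (t i))).
have mE i : mu (superlevel Omega phi (t i)) = (m i)%:E by rewrite fineK// superlevel_fin_num.
have m_mono i j : (i <= j)%N -> (m j <= m i)%R.
  move=> /tmono tij; rewrite -lee_fin -!mE; apply: le_lebn => z [Oz tz].
  by split => //; exact: le_trans tz.
have mN : (0 < m N)%R by rewrite -lte_fin -mE t_N.
have mpos i : (i <= N)%N -> (0 < m i)%R by move=> /m_mono; exact: lt_le_trans.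
have rootP i : exists b : R, (i <= N)%N -> (0 < b)%R /\ (b ^+ n.+1 = m i)%R.
  have [iN|] := leqP i N; last by exists 0%R.
  by have [b b0 bE] := exists_root (mpos _ iN) (ltn0Sn n); exists b.
have [b bP] := choice rootP.
have b0 i : (i <= N)%N -> (0 < b i)%R by move=> /bP[].
have bE i : (i <= N)%N -> (b i ^+ n.+1 = m i)%R by move=> /bP[].
have bd i : (i < N)%N -> (b i.+1 <= b i)%R.
  move=> iN; rewrite -(@ler_pXn2r _ n.+1) ?nnegrE ?(ltW (b0 _ _))//; last exact: ltnW.
  by rewrite !bE ?(ltnW iN)// m_mono.
have sumb := sum_ratio_ge b0 bd mN (fun i iN => eq_ind_r (fun x => m N <= x)%R (m_mono _ _ iN) (bE _ iN)).
pose G x := enorm (g x).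
(* b i is arbitrary for i > N; the truncation makes every coefficient nonnegative *)
pose c i : R := if (i < N)%N then ((b i ^+ n)^-1)%R else 0%R.
have c0 i : (0 <= c i)%R.
  by rewrite /c; case: ifP => // iN; rewrite invr_ge0 exprn_ge0// ltW// b0// ltnW.
pose A i := strip Omega phi (t i) (t i.+1).
have mA i : measurable (A i : set leb_type) by exact: measurable_strip.
have AO i : A i `<=` Omega by move=> x [].
have low : \sum_(i < N) (c i)%:E * \int[mu]_(x in A i) (G x)%:E <=
    \int[mu]_(x in Omega) weighted_grad x.
  rewrite -(integral_sum_scaled_indic (lebn R n.+1) N (measurable_Omega oOmega) c0 mA AO
    (fun x => enorm_ge0 (g x)) (measurable_enorm_g ig)).
  apply: ge0_le_integral_lower => x Ox.
    by rewrite sumEFin lee_fin sumr_ge0// => i _; rewrite !mulr_ge0// enorm_ge0.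
  rewrite sumEFin.
  have [[j Aj]|nA] := pselect (exists j : 'I_N, A j x); last first.
    rewrite big1 ?weighted_grad_ge0// => i _; rewrite indicE memNset ?mulr0//.
    by move=> Ai; apply: nA; exists i.
  rewrite (bigD1 j)//= big1 ?addr0 => [|i ij].
    rewrite indicE mem_set// mulr1 /c ltn_ord.
    case: Aj => _ /andP[tj _].
    by apply: (weighted_grad_lower (b0 _ (ltnW (ltn_ord j))) _ tj); rewrite mE bE// ltnW.
  rewrite indicE memNset ?mulr0// => -[_ /andP[h1 h2]].
  case: Aj => _ /andP[h3 h4].
  have [ij'|ji|ij'] := ltngtP (i : nat) j.
  - have tij := tmono _ _ ij'.
    by have := lt_le_trans h3 (le_trans h2 tij); rewrite ltxx.
  - have tji := tmono _ _ ji.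
    by have := lt_le_trans h1 (le_trans h4 tji); rewrite ltxx.
  - by move: ij; rewrite (val_inj ij') eqxx.
apply: (le_trans _ low).
have piece (i : 'I_N) : (n.+1%:R * w * h * (b i.+1 / b i) ^+ n)%:E <=
    (c i)%:E * \int[mu]_(x in A i) (G x)%:E.
  have bi : (0 < b i)%R by rewrite b0// ltnW.
  have bi1 : (0 < b i.+1)%R by rewrite b0.
  rewrite /c ltn_ord.
  have -> : (n.+1%:R * w * h * (b i.+1 / b i) ^+ n =
     (b i ^+ n)^-1 * (n.+1%:R * w * (t i.+1 - t i) * b i.+1 ^+ n))%R.
    by rewrite tS addrAC subrr add0r expr_div_n; ring.
  rewrite EFinM; apply: lee_wpmul2l; first by rewrite lee_fin invr_ge0 exprn_ge0// ltW.
  apply: (sobolev_level_bound w0 wE oOmega iphi ig approx) => //.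
    by rewrite tS ltrDl.
  by rewrite mE bE.
apply: (le_trans _ (lee_sum _ (fun i _ => piece i))).
rewrite sumEFin lee_fin -mulr_sumr.
apply: (le_trans _ (ler_wpM2l _ sumb)); last first.
  by rewrite mulr_ge0 ?(ltW h0)// mulr_ge0 ?ler0n ?(ltW w0).
rewrite !bE//.
have -> : (n.+1%:R * w * h * (N%:R - (m 0%N - m N) / m N) =
  n.+1%:R * w * (T - t0) * (1 - (m 0%N - m N) / m N / N%:R))%R.
  by rewrite /h; field; rewrite !gt_eqF.
have -> : fine (mu (superlevel Omega phi t0)) = m 0%N by rewrite /m t_0.
have -> : fine (mu (superlevel Omega phi T)) = m N by rewrite /m t_N.
rewrite ler_wpM2l ?mulr_ge0 ?subr_ge0 ?(ltW w0) ?(ltW t0T)//.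
rewrite lerD2l lerN2 ler_wpM2r ?invr_ge0 ?(ltW N0')//.
by rewrite ler_wpM2r ?invr_ge0 ?(ltW mN)// gerBl ltW.
Qed.

(** The error terms of the partition bound vanish as [t0] tends to zero and, for
fixed [t0], as the number of steps tends to infinity. *)
Lemma level_le_weighted (T : R) : (0 < T)%R -> 0 < mu (superlevel Omega phi T) ->
  (n.+1%:R * w * T)%:E <= \int[mu]_(x in Omega) weighted_grad x.
Proof.
move=> T0 ST; set J := \int[_]_(x in _) _.
have J0 : 0 <= J by apply: integral_ge0 => x _; exact: weighted_grad_ge0.
have [->|Jy] := eqVneq J +oo; first by rewrite leey.
have Jfin : J \is a fin_num by rewrite ge0_fin_numE// ltey.
rewrite -(fineK Jfin) lee_fin; set j := fine J.
have c0 : (0 < n.+1%:R * w)%R by rewrite mulr_gt0.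
apply/ler_addgt0Pr => e e0.
pose t0 := (Num.min (T / 2) (e / 2 / (n.+1%:R * w)))%R.
have t00 : (0 < t0)%R by rewrite lt_min !divr_gt0.
have t0T : (t0 < T)%R.
  by rewrite (@le_lt_trans _ _ (T / 2)%R)// ?ge_min ?lexx// ltr_pdivrMr// mulr_natr mulr2n ltrDl.
have t0e : (n.+1%:R * w * t0 <= e / 2)%R by rewrite mulrC -ler_pdivlMr// ge_min lexx orbT.
pose q := (n.+1%:R * w * (T - t0) *
  (fine (mu (superlevel Omega phi t0)) / fine (mu (superlevel Omega phi T))))%R.
have q0 : (0 <= q)%R.
  by rewrite !mulr_ge0 ?invr_ge0 ?fine_ge0 ?outer_measure_ge0 ?ler0n ?subr_ge0 ?(ltW w0) ?(ltW t0T).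
pose N := (Num.bound (q / (e / 2))).+1.
have qN : (q / N%:R <= e / 2)%R.
  rewrite ler_pdivrMr ?ltr0n// mulrC -ler_pdivrMr ?divr_gt0//.
  apply: ltW; apply: (@lt_trans _ _ (Num.bound (q / (e / 2)))%:R); last by rewrite ltr_nat.
  by rewrite archi_boundP// divr_ge0// divr_ge0// ltW.
have := partition_bound t00 t0T (ltn0Sn _ : (0 < N)%N) ST.
rewrite -/J -(fineK Jfin) lee_fin -/j -/N => h.
have := lerD (lerD h t0e) qN.
rewrite -[(j + e / 2 + e / 2)%R]addrA -splitr; apply: le_trans.
by rewrite le_eqVlt; apply/orP; left; apply/eqP; rewrite /q; ring.
Qed.

End rearrangement.

(** * Conclusion *)

Theorem proposition1p7 (R : realType) (n : nat) (hn : (2 <= n)%N)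
    (Omega : set 'rV[R]_n) (hOmega : open Omega)
    (phi : 'rV[R]_n -> R) (hphi : sobolev11_0 Omega phi)
    (hphi0 : {ae lebn R n, forall x, Omega x -> (0 <= phi x)%R})
    (gradphi : 'rV[R]_n -> 'rV[R]_n)
    (hgradphi : weak_gradient Omega phi gradphi) :
  Linfty_norm Omega phi <=
    (n%:R%:E * unit_ball_measure R n `^ n%:R^-1)^-1 *
    \int[lebn R n]_(x in Omega)
      ((enorm (gradphi x))%:E /
       (lebn R n [set z | Omega z /\ (phi x <= phi z)%R]) `^ (n.-1%:R / n%:R)).
Proof.
case: n hn Omega hOmega phi hphi hphi0 gradphi hgradphi => [//|n] _ Omega oOmega phi
  [[iphi _] approx0] phi0 g wg.
have approx := approx0 _ wg; have [ig _] := wg.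
have omega0 : (0 < fine (lebesgue_rV R n.+1 (@eball R n.+1 1)))%R.
  by rewrite fine_gt0// lebesgue_rV_eball_gt0/= ltey_eq lebesgue_rV_eball_fin.
have [w w0 wE'] := exists_root omega0 (ltn0Sn n).
have wE : (w ^+ n.+1)%:E = lebesgue_rV R n.+1 (@eball R n.+1 1).
  by rewrite wE' fineK// lebesgue_rV_eball_fin.
have c0 : (0 < n.+1%:R * w)%R by rewrite mulr_gt0.
have -> : unit_ball_measure R n.+1 `^ n.+1%:R^-1 = w%:E.
  rewrite /unit_ball_measure lebnE; last exact: measurable_eball.
  rewrite -/(@eball R n.+1 1) -wE poweR_EFin -powR_mulrn ?(ltW w0)// -powRrM.
  by rewrite divff ?pnatr_eq0// powRr1// ltW.
rewrite -EFinM inver gt_eqF//.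
set J := \int[_]_(x in _) _.
have J0 : 0 <= J by apply: integral_ge0 => x _; exact: (weighted_grad_ge0 Omega phi g x).
set X := _ * J.
have X0 : 0 <= X by rewrite mule_ge0// lee_fin invr_ge0 ltW.
have [->|Xy] := eqVneq X +oo; first by rewrite leey.
have Xfin : X \is a fin_num by rewrite ge0_fin_numE// ltey.
(* a level whose superlevel set has positive measure is at most X *)
have null (T : R) : (fine X < T)%R -> lebn R n.+1 (superlevel Omega phi T) = 0.
  move=> XT; have T0 : (0 < T)%R by rewrite (le_lt_trans _ XT)// fine_ge0.
  apply/eqP; rewrite eq_le outer_measure_ge0 andbT leNgt; apply/negP => ST.
  have := level_le_weighted w0 wE oOmega iphi ig approx T0 ST.
  rewrite -/J => cTJ.
  have : T%:E <= X.
    have ci0 : 0 <= ((n.+1%:R * w)^-1)%R%:E by rewrite lee_fin invr_ge0 ltW.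
    by have := lee_wpmul2l ci0 cTJ; rewrite -EFinM mulKf ?gt_eqF.
  by rewrite -(fineK Xfin) lee_fin leNgt XT.
rewrite /Linfty_norm unlock /=; case: ifPn => // _.
apply/ess_supP.
have nullk : \forall x \ae lebn R n.+1, forall k : nat,
    ~ superlevel Omega phi (fine X + k.+1%:R^-1)%R x.
  apply/ae_foralln => k; exists (superlevel Omega phi (fine X + k.+1%:R^-1)%R).
  split; [exact: measurable_superlevel|by apply: null; rewrite ltrDl invr_gt0|].
  by move=> x /=; apply: contrapT.
apply: (@filterS2 _ _ (ae_filter_ringOfSetsType (lebn R n.+1)) _ _ _ _ phi0 nullk) => x phix xk; rewrite /= patchE.
case: ifPn => [/set_mem Ox|_]; last by rewrite /= normr0.
rewrite /= ger0_norm ?phix// -(fineK Xfin) lee_fin leNgt; apply/negP => Xphi.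
have d0 : (0 < phi x - fine X)%R by rewrite subr_gt0.
have [k _ /(_ k (leqnn k)) /= kP] := near_infty_natSinv_lt (PosNum d0).
by apply: (xk k); split => //; rewrite -lerBrDl ltW.
Qed.
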